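(* Let $A_G$ and $A'_G$ be strongly $G$-graded algebras over a field $\mathbb{F}$, and let $W_G$ and $W'_G$ be $G$-graded left modules over $A_G$ and $A'_G$ respectively. Suppose that $W_G$ and $W'_G$ are finitely presented as ungraded modules over $A_G$ and $A'_G$ respectively. Then there is a $G$-graded isomorphism of algebras $$\mathrm{End}^{\mathrm{r}(G)}_{A_G}(W_G)\otimes^G_{\mathbb{F}}\mathrm{End}^{\mathrm{r}(G)}_{A'_G}(W'_G)\stackrel{G}{\cong}\mathrm{End}^{\mathrm{r}(G)}_{A_G\otimes^G_{\mathbb{F}}A'_G}(W_G\otimes^G_{\mathbb{F}}W'_G).$$
   Context: Algebras are associative and unital. A $G$-graded $\mathbb{F}$-algebra is $A_G=\bigoplus_{g\in G}A_g$ with $A_gA_h\subseteq A_{gh}$; it is strongly graded if $A_gA_h=A_{gh}$ for all $g,h\in G$. A $G$-graded left $A_G$-module is $W_G=\bigoplus_gW_g$ with $A_gW_h\subseteq W_{gh}$. The graded product of $G$-graded algebras is the $G$-graded subalgebra $A_G\otimes^G_{\mathbb{F}}A'_G=\bigoplus_gA_g\otimes_{\mathbb{F}}A'_g$ of $A_G\otimes_{\mathbb{F}}A'_G$; the graded product of modules is $W_G\otimes^G_{\mathbb{F}}W'_G=\bigoplus_gW_g\otimes_{\mathbb{F}}W'_g$, a graded left $A_G\otimes^G_{\mathbb{F}}A'_G$-module by $(a_g\otimes a'_g)(w_h\otimes w'_h)=a_gw_h\otimes a'_gw'_h$. $\mathrm{End}^{\mathrm{r}(G)}_{A_G}(W_G)=\bigoplus_{g}\mathrm{End}^{\mathrm{r}(g)}_{A_G}(W_G)$,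 where $\mathrm{End}^{\mathrm{r}(g)}_{A_G}(W_G)$ is the set of $A_G$-endomorphisms mapping $W_h$ into $W_{hg}$ for all $h\in G$; it acts from the right (the product $\phi\psi$ means first $\phi$, then $\psi$) and is a $G$-graded algebra. $\stackrel{G}{\cong}$ denotes a degree-preserving isomorphism. *)

(* Defs.v *)
From HB Require Import structures.
From mathcomp Require Import all_boot all_algebra.
From mathcomp Require Import boolp classical_sets.

Set Implicit Arguments.
Unset Strict Implicit.
Unset Printing Implicit Defensive.

Import GRing.Theory.
Local Open Scope classical_set_scope.
Local Open Scope ring_scope.
Local Open Scope quotient_scope.

(* [algType] is built on [nzRingType] and so excludes the zero algebra, but
   the endomorphism algebra of the zero module is zero.  [pzAlgType R] is the
   type of associative unital [R]-algebras, the zero algebra included. *)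
HB.mixin Record PzRing_isPzAlgebra (R : pzRingType) A of GRing.PzRing A := {
  algscale : R -> A -> A;
  algscaleA : forall a b x, algscale a (algscale b x) = algscale (a * b) x;
  algscale1 : left_id 1 algscale;
  algscaleDr : right_distributive algscale +%R;
  algscaleDl : forall x, {morph algscale^~ x : a b / a + b};
  algscaleAl : forall a (x y : A), algscale a (x * y) = algscale a x * y;
  algscaleAr : forall a (x y : A), algscale a (x * y) = x * algscale a y
}.

#[short(type="pzAlgType")]
HB.structure Definition PzAlgebra (R : pzRingType) :=
  {A of GRing.PzRing A & PzRing_isPzAlgebra R A}.

HB.instance Definition _ (R : pzRingType) (A : pzAlgType R) :=
  GRing.Zmodule_isLmodule.Build R (PzAlgebra.sort A)
    (@algscaleA R A) (@algscale1 R A) (@algscaleDr R A) (@algscaleDl R A).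

Section PzAlgebraTheory.
Variables (R : pzRingType) (A : pzAlgType R).

Lemma pzscalerAl (a : R) (x y : A) : a *: (x * y) = (a *: x) * y.
Proof. exact: algscaleAl. Qed.

Lemma pzscalerAr (a : R) (x y : A) : a *: (x * y) = x * (a *: y).
Proof. exact: algscaleAr. Qed.

End PzAlgebraTheory.

(* An A-module as an F-module, through a |-> a *: 1. *)
Section RestrictionOfScalars.
Variables (F : pzRingType) (A : pzAlgType F) (W : lmodType A).

Definition restr : Type := W.

HB.instance Definition _ := GRing.Zmodule.on restr.

Definition restr_scale (a : F) (w : restr) : restr := (a *: (1 : A)) *: (w : W).

Lemma restr_scaleA a b w :
  restr_scale a (restr_scale b w) = restr_scale (a * b) w.
Proof.
by rewrite /restr_scale scalerA -pzscalerAl mul1r scalerA.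
Qed.

Lemma restr_scale1 : left_id 1 restr_scale.
Proof. by move=> w; rewrite /restr_scale !scale1r. Qed.

Lemma restr_scaleDr : right_distributive restr_scale +%R.
Proof. by move=> a u v; rewrite /restr_scale scalerDr. Qed.

Lemma restr_scaleDl w : {morph restr_scale^~ w : a b / a + b}.
Proof. by move=> a b; rewrite /restr_scale !scalerDl. Qed.

HB.instance Definition _ := GRing.Zmodule_isLmodule.Build F restr
  restr_scaleA restr_scale1 restr_scaleDr restr_scaleDl.

End RestrictionOfScalars.

(* Tensor product over F: finite formal sums of pairs (represented as lists)
   modulo the least additive congruence making the class of (v, w) bilinear. *)
Section TensorProduct.
Variables (F : fieldType) (V W : lmodType F).

Inductive tens_rel : seq (V * W) -> seq (V * W) -> Prop :=
| TensRefl s : tens_rel s s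
| TensSym s t : tens_rel s t -> tens_rel t s
| TensTrans s t u : tens_rel s t -> tens_rel t u -> tens_rel s u
| TensCat s s' t t' :
    tens_rel s s' -> tens_rel t t' -> tens_rel (s ++ t) (s' ++ t')
| TensCatC s t : tens_rel (s ++ t) (t ++ s)
| TensZero w : tens_rel [:: (0, w)] [::]
| TensDl v v' w : tens_rel [:: (v + v', w)] [:: (v, w); (v', w)]
| TensDr v w w' : tens_rel [:: (v, w + w')] [:: (v, w); (v, w')]
| TensZ a v w : tens_rel [:: (a *: v, w)] [:: (v, a *: w)].

Definition tens_relb (s t : seq (V * W)) : bool := `[< tens_rel s t >].

Lemma tens_rel_equiv : equiv_class_of tens_relb.
Proof.
split=> [s|s t|t s u].
- by apply/asboolP; apply: TensRefl.
- by apply/asboolP/asboolP; apply: TensSym.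
- by move=> /asboolP st /asboolP tu; apply/asboolP; apply: TensTrans st tu.
Qed.

Canonical tens_equiv := EquivRelPack tens_rel_equiv.

Definition tens := {eq_quot tens_equiv}.

HB.instance Definition _ := Choice.on tens.
HB.instance Definition _ := EqQuotient.on tens.

Definition tpi (s : seq (V * W)) : tens := \pi_tens s.

Lemma tpi_ind (P : tens -> Prop) : (forall s, P (tpi s)) -> forall x, P x.
Proof. by move=> Ppi x; rewrite -[x]reprK; apply: Ppi. Qed.

Lemma tens_piP (s t : seq (V * W)) :
  tens_rel s t <-> tpi s = tpi t.
Proof.
split=> [st|/eqP]; first by apply/eqP; rewrite /tpi eqmodE; apply/asboolP.
by rewrite /tpi eqmodE => /asboolP.
Qed.

Lemma tpi_repr x : tpi (repr x) = x.
Proof. exact: reprK. Qed.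

Lemma tens_repr (s : seq (V * W)) : tens_rel (repr (tpi s)) s.
Proof. by apply/tens_piP; rewrite tpi_repr. Qed.

Definition tens_add (x y : tens) : tens := tpi (repr x ++ repr y).
Definition tens_zero : tens := tpi [::].
Definition tens_opp (x : tens) : tens :=
  tpi [seq (- p.1, p.2) | p <- repr x].

Lemma tens_add_pi s t : tens_add (tpi s) (tpi t) = tpi (s ++ t).
Proof. by apply/tens_piP; apply: TensCat; apply: tens_repr. Qed.

Lemma tens_rel_map (f : V -> V) : f 0 = 0 ->
    {morph f : u v / u + v} -> (forall a, {morph f : v / a *: v}) ->
  forall s t, tens_rel s t ->
  tens_rel [seq (f p.1, p.2) | p <- s] [seq (f p.1, p.2) | p <- t].
Proof.
move=> f0 fD fZ s t; elim=> {s t} /=.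
- by move=> s; apply: TensRefl.
- by move=> s t _; apply: TensSym.
- by move=> s t u _ + _; apply: TensTrans.
- by move=> s s' t t' _ + _ +; rewrite !map_cat; apply: TensCat.
- by move=> s t; rewrite !map_cat; apply: TensCatC.
- by move=> w; rewrite f0; apply: TensZero.
- by move=> v v' w; rewrite fD; apply: TensDl.
- by move=> v w w'; apply: TensDr.
- by move=> a v w; rewrite fZ; apply: TensZ.
Qed.

Lemma tens_addA : associative tens_add.
Proof.
move=> x y z; elim/tpi_ind: x => s; elim/tpi_ind: y => t; elim/tpi_ind: z => u.
by rewrite !tens_add_pi catA.
Qed.

Lemma tens_addC : commutative tens_add.
Proof.
move=> x y; elim/tpi_ind: x => s; elim/tpi_ind: y => t; rewrite !tens_add_pi.
by apply/tens_piP; apply: TensCatC.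
Qed.

Lemma tens_add0 : left_id tens_zero tens_add.
Proof. by move=> x; elim/tpi_ind: x => s; rewrite tens_add_pi. Qed.

Lemma tens_opp_pi s :
  tens_opp (tpi s) = tpi [seq (- p.1, p.2) | p <- s].
Proof.
apply/tens_piP; apply: tens_rel_map (tens_repr s).
- exact: oppr0.
- by move=> u v; rewrite opprD.
- by move=> a v; rewrite scalerN.
Qed.

Lemma tens_addN : left_inverse tens_zero tens_opp tens_add.
Proof.
move=> x; elim/tpi_ind: x => s; rewrite tens_opp_pi tens_add_pi; apply/tens_piP.
elim: s => [|[v w] s IHs] /=; first exact: TensRefl.
set L := map _ s in IHs *.
have -> : (- v, w) :: L ++ (v, w) :: s =
          [:: (- v, w)] ++ ((L ++ [:: (v, w)]) ++ s) by rewrite -catA.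
apply: (@TensTrans _ ([:: (- v, w)] ++ (([:: (v, w)] ++ L) ++ s))).
  apply: TensCat; first exact: TensRefl.
  by apply: TensCat; [apply: TensCatC | apply: TensRefl].
apply: (@TensCat [:: (- v, w); (v, w)] [::] (L ++ s) [::]) IHs.
apply: TensTrans (TensSym (TensDl _ _ _)) _.
by rewrite addNr; apply: TensZero.
Qed.

HB.instance Definition _ :=
  GRing.isZmodule.Build tens tens_addA tens_addC tens_add0 tens_addN.

Lemma tpiD s t : tpi (s ++ t) = tpi s + tpi t.
Proof. exact: esym (tens_add_pi s t). Qed.

Definition tpure (v : V) (w : W) : tens := tpi [:: (v, w)].

Lemma tens_piE s : tpi s = \sum_(p <- s) tpure p.1 p.2.
Proof.
elim: s => [|[v w] s IHs]; first by rewrite big_nil.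
by rewrite big_cons -IHs; apply: esym; apply: tens_add_pi.
Qed.

Lemma tens_reprE (x : tens) : x = \sum_(p <- repr x) tpure p.1 p.2.
Proof. by rewrite -tens_piE tpi_repr. Qed.

Lemma tpureDl v v' w : tpure (v + v') w = tpure v w + tpure v' w.
Proof.
by apply: etrans (esym (tens_add_pi _ _)); apply/tens_piP; apply: TensDl.
Qed.

Lemma tpureDr v w w' : tpure v (w + w') = tpure v w + tpure v w'.
Proof.
by apply: etrans (esym (tens_add_pi _ _)); apply/tens_piP; apply: TensDr.
Qed.

Lemma tpureZ a v w : tpure (a *: v) w = tpure v (a *: w).
Proof. by apply/tens_piP; apply: TensZ. Qed.

Lemma tpure0l w : tpure 0 w = 0.
Proof. by apply/tens_piP; apply: TensZero. Qed.

Definition tens_scale (a : F) (x : tens) : tens :=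
  tpi [seq (a *: p.1, p.2) | p <- repr x].

Lemma tens_scale_pi a s :
  tens_scale a (tpi s) = tpi [seq (a *: p.1, p.2) | p <- s].
Proof.
apply/tens_piP; apply: tens_rel_map (tens_repr s).
- exact: scaler0.
- by move=> u v; rewrite scalerDr.
- by move=> b v; rewrite !scalerA mulrC.
Qed.

Lemma tens_scaleA a b x :
  tens_scale a (tens_scale b x) = tens_scale (a * b) x.
Proof.
elim/tpi_ind: x => s; rewrite !tens_scale_pi -map_comp.
by congr (tpi _); apply: eq_map => p /=; rewrite scalerA.
Qed.

Lemma tens_scale1 : left_id 1 tens_scale.
Proof.
move=> x; elim/tpi_ind: x => s; rewrite tens_scale_pi; congr (tpi _).
by rewrite -[RHS]map_id; apply: eq_map => -[v w] /=; rewrite scale1r.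
Qed.

Lemma tens_scaleDr : right_distributive tens_scale +%R.
Proof.
move=> a x y; elim/tpi_ind: x => s; elim/tpi_ind: y => t.
by rewrite -tpiD !tens_scale_pi -tpiD map_cat.
Qed.

Lemma tens_scaleDl x : {morph tens_scale^~ x : a b / a + b}.
Proof.
move=> a b; elim/tpi_ind: x => s; rewrite !tens_scale_pi !tens_piE !big_map.
rewrite -big_split /=; apply: eq_bigr => p _.
by rewrite scalerDl tpureDl.
Qed.

HB.instance Definition _ := GRing.Zmodule_isLmodule.Build F tens
  tens_scaleA tens_scale1 tens_scaleDr tens_scaleDl.

Lemma scale_tpure a v w : a *: tpure v w = tpure (a *: v) w.
Proof. exact: tens_scale_pi. Qed.

End TensorProduct.

Section TensorMaps.
Variables (F : fieldType).

Record bilin (V W U : lmodType F) (f : V -> W -> U) : Prop := Bilin {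
  bilinDl : forall v v' w, f (v + v') w = f v w + f v' w;
  bilinDr : forall v w w', f v (w + w') = f v w + f v w';
  bilinZl : forall a v w, f (a *: v) w = a *: f v w;
  bilinZr : forall a v w, f v (a *: w) = a *: f v w }.

Lemma bilin_tpure (V W : lmodType F) : bilin (@tpure F V W).
Proof.
split=> *; [exact: tpureDl | exact: tpureDr | by rewrite scale_tpure |].
by rewrite scale_tpure tpureZ.
Qed.

Section Lift.
Variables (V W U : lmodType F) (f : V -> W -> U).

Definition tlift (x : tens V W) : U := \sum_(p <- repr x) f p.1 p.2.

Hypothesis fbil : bilin f.

Lemma bilin0l w : f 0 w = 0.
Proof. by rewrite -[X in f X](scale0r 0) bilinZl // scale0r. Qed.

Lemma bilin_suml I (s : seq I) (v : I -> V) w :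
  f (\sum_(i <- s) v i) w = \sum_(i <- s) f (v i) w.
Proof.
elim: s => [|i s IHs]; first by rewrite !big_nil bilin0l.
by rewrite !big_cons bilinDl // IHs.
Qed.

Lemma tens_rel_lift s t : tens_rel s t ->
  \sum_(p <- s) f p.1 p.2 = \sum_(p <- t) f p.1 p.2.
Proof.
elim=> {s t}.
- by [].
- by move=> s t _ ->.
- by move=> s t u _ -> _ ->.
- by move=> s s' t t' _ E _ E'; rewrite !big_cat E E'.
- by move=> s t; rewrite !big_cat /= addrC.
- by move=> w; rewrite big_seq1 big_nil /= bilin0l.
- by move=> v v' w; rewrite big_seq1 big_cons big_seq1 /= bilinDl.
- by move=> v w w'; rewrite big_seq1 big_cons big_seq1 /= bilinDr.
- by move=> a v w; rewrite !big_seq1 /= bilinZl // bilinZr.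
Qed.

Lemma tlift_pi s : tlift (tpi s) = \sum_(p <- s) f p.1 p.2.
Proof. exact/tens_rel_lift/tens_repr. Qed.

Lemma tlift_pure v w : tlift (tpure v w) = f v w.
Proof. by rewrite tlift_pi big_seq1. Qed.

Lemma tliftD x y : tlift (x + y) = tlift x + tlift y.
Proof.
elim/tpi_ind: x => s; elim/tpi_ind: y => t.
by rewrite -tpiD !tlift_pi big_cat.
Qed.

Lemma tliftZ a x : tlift (a *: x) = a *: tlift x.
Proof.
elim/tpi_ind: x => s; rewrite [a *: _]tens_scale_pi !tlift_pi big_map scaler_sumr.
by apply: eq_bigr => p _; rewrite bilinZl.
Qed.

Lemma tlift0 : tlift 0 = 0.
Proof. by rewrite -(scale0r 0) tliftZ scale0r. Qed.

Lemma tlift_sum I (s : seq I) (x : I -> tens V W) :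
  tlift (\sum_(i <- s) x i) = \sum_(i <- s) tlift (x i).
Proof.
elim: s => [|i s IHs]; first by rewrite !big_nil tlift0.
by rewrite !big_cons tliftD IHs.
Qed.

End Lift.

(* [tmap2 f g] is the bilinear map with
   (v1 (x) w1, v2 (x) w2) |-> f v1 v2 (x) g w1 w2. *)
Section Map2.
Variables (V1 V2 V3 W1 W2 W3 : lmodType F).
Variables (f : V1 -> V2 -> V3) (g : W1 -> W2 -> W3).

Definition tmap2 (x : tens V1 W1) (y : tens V2 W2) : tens V3 W3 :=
  tlift (fun v1 w1 => tlift (fun v2 w2 => tpure (f v1 v2) (g w1 w2)) y) x.

Hypotheses (fbil : bilin f) (gbil : bilin g).

Lemma bilin_inner v1 w1 : bilin (fun v2 w2 => tpure (f v1 v2) (g w1 w2)).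
Proof.
split=> *; rewrite ?(bilinDr fbil, bilinDr gbil, bilinZr fbil, bilinZr gbil).
- exact: tpureDl.
- exact: tpureDr.
- by rewrite scale_tpure.
- by rewrite scale_tpure tpureZ.
Qed.

Lemma bilin_outer y :
  bilin (fun v1 w1 => tlift (fun v2 w2 => tpure (f v1 v2) (g w1 w2)) y).
Proof.
elim/tpi_ind: y => s.
split=> *; rewrite !(tlift_pi (bilin_inner _ _)) ?scaler_sumr -?big_split /=;
  apply: eq_bigr => p _.
- by rewrite (bilinDl fbil) tpureDl.
- by rewrite (bilinDl gbil) tpureDr.
- by rewrite (bilinZl fbil) scale_tpure.
- by rewrite (bilinZl gbil) scale_tpure tpureZ.
Qed.

Lemma tmap2_pure v1 w1 v2 w2 :
  tmap2 (tpure v1 w1) (tpure v2 w2) = tpure (f v1 v2) (g w1 w2).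
Proof.
by rewrite /tmap2 (tlift_pure (bilin_outer _)) (tlift_pure (bilin_inner _ _)).
Qed.

Lemma bilin_tmap2 : bilin tmap2.
Proof.
have eD x y y' : tmap2 x (y + y') = tmap2 x y + tmap2 x y'.
  elim/tpi_ind: x => s; rewrite /tmap2 !(tlift_pi (bilin_outer _)) -big_split /=.
  by apply: eq_bigr => p _; rewrite (tliftD (bilin_inner _ _)).
have eZ a x y : tmap2 x (a *: y) = a *: tmap2 x y.
  elim/tpi_ind: x => s; rewrite /tmap2 !(tlift_pi (bilin_outer _)) scaler_sumr.
  by apply: eq_bigr => p _; rewrite (tliftZ (bilin_inner _ _)).
split=> //.
- by move=> x x' y; rewrite /tmap2 (tliftD (bilin_outer _)).
- by move=> a x y; rewrite /tmap2 (tliftZ (bilin_outer _)).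
Qed.

End Map2.

Lemma bilin_sumr (V W U : lmodType F) (f : V -> W -> U) (fbil : bilin f)
    I (s : seq I) v (w : I -> W) :
  f v (\sum_(i <- s) w i) = \sum_(i <- s) f v (w i).
Proof.
have flip : bilin (fun w v => f v w).
  by case: fbil => a b c d; split=> *; rewrite ?a ?b ?c ?d.
exact: (bilin_suml flip).
Qed.

Lemma tens_ind (V W : lmodType F) (P : tens V W -> Prop) :
  P 0 -> (forall x y, P x -> P y -> P (x + y)) ->
  (forall v w, P (tpure v w)) -> forall x, P x.
Proof.
move=> P0 PD Pp x; rewrite (tens_reprE x).
by elim/big_ind: _ => // p _; apply: Pp.
Qed.

End TensorMaps.

Section TensorAlgebra.
Variables (F : fieldType) (A A' : pzAlgType F).

Lemma bilin_mul (B : pzAlgType F) : bilin (@GRing.mul B).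
Proof.
split=> *; [exact: mulrDl | exact: mulrDr | |].
- by rewrite pzscalerAl.
- by rewrite pzscalerAr.
Qed.

Definition tens_mul : tens A A' -> tens A A' -> tens A A' :=
  tmap2 (@GRing.mul A) (@GRing.mul A').

Definition tens_one : tens A A' := tpure (1 : A) (1 : A').

Lemma bilin_tens_mul : bilin tens_mul.
Proof. by apply: bilin_tmap2; apply: bilin_mul. Qed.

Lemma tens_mul_pure a a' b b' :
  tens_mul (tpure a a') (tpure b b') = tpure (a * b) (a' * b').
Proof. by apply: tmap2_pure; apply: bilin_mul. Qed.

Let mD := bilinDl bilin_tens_mul.
Let mDr := bilinDr bilin_tens_mul.
Let m0l := bilin0l bilin_tens_mul.
Let m0r x : tens_mul x 0 = 0.
Proof.
have := bilin_sumr bilin_tens_mul [::] x (fun _ : unit => 0).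
by rewrite !big_nil.
Qed.

Lemma tens_mulA : associative tens_mul.
Proof.
move=> x y z.
elim/tens_ind: x => [|x x' IH IH'|a a']; first by rewrite !m0l.
  by rewrite !mD IH IH'.
elim/tens_ind: y => [|y y' IH IH'|b b']; first by rewrite !(m0l, m0r).
  by rewrite !(mD, mDr) IH IH'.
elim/tens_ind: z => [|z z' IH IH'|c c']; first by rewrite !m0r.
  by rewrite !mDr IH IH'.
by rewrite !tens_mul_pure !mulrA.
Qed.

Lemma tens_mul1 : left_id tens_one tens_mul.
Proof.
move=> x; elim/tens_ind: x => [|x x' IH IH'|a a']; first by rewrite m0r.
  by rewrite mDr IH IH'.
by rewrite tens_mul_pure !mul1r.
Qed.

Lemma tens_mulr1 : right_id tens_one tens_mul.
Proof.
move=> x; elim/tens_ind: x => [|x x' IH IH'|a a']; first by rewrite m0l.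
  by rewrite mD IH IH'.
by rewrite tens_mul_pure !mulr1.
Qed.

HB.instance Definition _ := GRing.Zmodule_isPzRing.Build (tens A A')
  tens_mulA tens_mul1 tens_mulr1
  (fun x y z => mD x y z) (fun x y z => mDr x y z).

Lemma tens_scaleAl (a : F) (x y : tens A A') : a *: (x * y) = (a *: x) * y.
Proof. exact: esym (bilinZl bilin_tens_mul a x y). Qed.

Lemma tens_scaleAr (a : F) (x y : tens A A') : a *: (x * y) = x * (a *: y).
Proof. exact: esym (bilinZr bilin_tens_mul a x y). Qed.

HB.instance Definition _ := PzRing_isPzAlgebra.Build F (tens A A')
  (@scalerA _ _) (@scale1r _ _) (@scalerDr _ _) (fun x a b => scalerDl x a b)
  tens_scaleAl tens_scaleAr.

End TensorAlgebra.

Section DirectSums.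
Variables (G : choiceType) (V : zmodType).
Implicit Types C : G -> set V.

Definition subgroup (S : set V) : Prop :=
  S 0 /\ forall u v, S u -> S v -> S (u - v).

Definition sum_of C : set V := [set x | exists (s : seq G) (c : G -> V),
  [/\ uniq s, forall g, C g (c g) & x = \sum_(g <- s) c g]].

Definition independent C : Prop := forall (s : seq G) (c : G -> V),
  uniq s -> (forall g, C g (c g)) -> \sum_(g <- s) c g = 0 ->
  forall g, g \in s -> c g = 0.

Definition direct_sum C : Prop := sum_of C = setT /\ independent C.

Section Theory.
Variables (C : G -> set V).
Hypothesis (Csub : forall g, subgroup (C g)).

Lemma sg0 g : C g 0. Proof. by case: (Csub g). Qed.
Lemma sgB g u v : C g u -> C g v -> C g (u - v).
Proof. by case: (Csub g) => _; apply. Qed.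
Lemma sgN g u : C g u -> C g (- u).
Proof. by move=> Cu; rewrite -sub0r; apply: sgB => //; apply: sg0. Qed.
Lemma sgD g u v : C g u -> C g v -> C g (u + v).
Proof. by move=> Cu Cv; rewrite -[v]opprK; apply: sgB => //; apply: sgN. Qed.
Lemma sg_sum g I (s : seq I) (P : pred I) (u : I -> V) :
  (forall i, P i -> C g (u i)) -> C g (\sum_(i <- s | P i) u i).
Proof. by move=> Cu; elim/big_ind: _ => //; [apply: sg0 | apply: sgD]. Qed.

Definition is_dec (x : V) (c : G -> V) (s : seq G) : Prop :=
  [/\ uniq s, forall g, C g (c g), forall g, g \notin s -> c g = 0 &
      x = \sum_(g <- s) c g].

Lemma sum_widen (s t : seq G) (c : G -> V) : uniq s -> uniq t ->
  {subset s <= t} -> (forall g, g \notin s -> c g = 0) ->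
  \sum_(g <- s) c g = \sum_(g <- t) c g.
Proof.
move=> us ut st c0; rewrite [RHS](bigID (mem s)) /= [X in _ + X]big1 ?addr0 //.
rewrite -[RHS]big_filter; apply: perm_big; apply: uniq_perm => //.
  exact: filter_uniq.
by move=> g; rewrite mem_filter andb_idr //; apply: st.
Qed.

Lemma sum_ofP x : sum_of C x -> exists c s, is_dec x c s.
Proof.
move=> [s [c [us Cc ->]]]; exists (fun g => if g \in s then c g else 0), s.
split=> // [g|g /negbTE -> //|]; first by case: ifP => // _; apply: sg0.
by apply: eq_big_seq => g ->.
Qed.

Lemma is_dec_sum_of x c s : is_dec x c s -> sum_of C x.
Proof. by case=> us Cc _ ->; exists s, c. Qed.

Lemma is_decB x y c d s t : is_dec x c s -> is_dec y d t ->
  is_dec (x - y) (fun g => c g - d g) (undup (s ++ t)).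
Proof.
move=> [us Cc c0 ->] [ut Cd d0 ->]; split.
- exact: undup_uniq.
- by move=> g; apply: sgB.
- by move=> g; rewrite mem_undup mem_cat => /norP[gs gt]; rewrite c0 // d0 // subr0.
- rewrite sumrB; congr (_ - _); apply: sum_widen; rewrite ?undup_uniq //.
  + by move=> g gs; rewrite mem_undup mem_cat gs.
  + by move=> g gt; rewrite mem_undup mem_cat gt orbT.
Qed.

Lemma is_dec_hom g x : C g x -> is_dec x (fun h => if h == g then x else 0) [:: g].
Proof.
move=> Cx; split=> // [h|h|]; last by rewrite big_seq1 eqxx.
- by case: eqP => [->|_] //; apply: sg0.
- by rewrite inE => /negbTE ->.
Qed.

Lemma sum_of_hom g x : C g x -> sum_of C x.
Proof. by move/is_dec_hom/is_dec_sum_of. Qed.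

Lemma sum_of_subgroup : subgroup (sum_of C).
Proof.
split.
  by exists [::], (fun=> 0); split=> [||]; rewrite ?big_nil // => g; exact: (sg0 g).
move=> x y /sum_ofP[c [s xc]] /sum_ofP[d [t yd]].
exact: is_dec_sum_of (is_decB xc yd).
Qed.

Lemma sum_ofD x y : sum_of C x -> sum_of C y -> sum_of C (x + y).
Proof.
move=> Sx Sy; have [S0 SB] := sum_of_subgroup.
by rewrite -[y]opprK -[- y]sub0r; apply: (SB) => //; apply: SB.
Qed.

Lemma sum_of_ind (P : V -> Prop) : P 0 -> (forall x y, P x -> P y -> P (x + y)) ->
  (forall g x, C g x -> P x) -> forall x, sum_of C x -> P x.
Proof.
move=> P0 PD Ph x [s [c [_ Cc ->]]]; elim/big_ind: _ => // g _.
exact: (Ph g).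
Qed.

Hypothesis (Cindep : independent C).

Lemma is_dec_uniq x c d s t : is_dec x c s -> is_dec x d t -> c =1 d.
Proof.
move=> xc xd g; case: (is_decB xc xd) => us Cc c0; rewrite subrr => /esym E.
apply/eqP; rewrite -subr_eq0; apply/eqP.
have [gs|] := boolP (g \in undup (s ++ t)); last exact: c0.
exact: (Cindep us Cc E).
Qed.

End Theory.
End DirectSums.

Section Projections.
Variables (F : fieldType) (G : choiceType) (V : lmodType F) (C : G -> set V).

Definition subspace (S : set V) : Prop :=
  S 0 /\ forall (a : F) u v, S u -> S v -> S (a *: u + v).

Lemma subspace_subgroup S : subspace S -> subgroup S.
Proof.
case=> S0 SD; split=> // u v Su Sv.
by rewrite -scaleN1r addrC; apply: SD.
Qed.

Lemma subspaceZ S : subspace S -> forall a u, S u -> S (a *: u).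
Proof. by case=> S0 SD a u Su; rewrite -[X in S X]addr0; apply: SD. Qed.

Hypotheses (Csub : forall g, subspace (C g)) (CV : direct_sum C).

Let Cg g := subspace_subgroup (Csub g).

Lemma proj_subproof x : exists c, exists s, is_dec C x c s.
Proof. by apply: sum_ofP => //; case: CV => ->. Qed.

Definition proj (g : G) (x : V) : V := projT1 (cid (proj_subproof x)) g.

Lemma projP x : exists s, is_dec C x (proj^~ x) s.
Proof. by rewrite /proj; case: cid. Qed.

Lemma proj_dec x c s : is_dec C x c s -> forall g, proj g x = c g.
Proof.
move=> xc g; have [t xp] := projP x.
exact: (is_dec_uniq Cg (proj2 CV) xp xc).
Qed.

Lemma proj_hom g h x : C h x -> proj g x = if g == h then x else 0.
Proof. by move=> /(is_dec_hom Cg)/proj_dec ->. Qed.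

Lemma projB g x y : proj g (x - y) = proj g x - proj g y.
Proof.
have [s xs] := projP x; have [t yt] := projP y.
by rewrite (proj_dec (is_decB Cg xs yt)).
Qed.

Lemma projD g x y : proj g (x + y) = proj g x + proj g y.
Proof.
have p0 : proj g 0 = 0 by have := projB g 0 0; rewrite !subrr.
by rewrite -[y in LHS]opprK projB -[- y]sub0r projB p0 sub0r opprK.
Qed.

Lemma projZ g a x : proj g (a *: x) = a *: proj g x.
Proof.
have [s [us Cc c0 E]] := projP x.
apply: (@proj_dec (a *: x) (fun h => a *: proj h x) s); split=> //.
- by move=> h; apply: subspaceZ.
- by move=> h /c0 ->; rewrite scaler0.
- by rewrite {1}E scaler_sumr.
Qed.

End Projections.

Section TensorGrading.
Variables (F : fieldType) (G : choiceType) (V W : lmodType F).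
Variables (C : G -> set V) (D : G -> set W).

Definition tens_comp (g : G) : set (tens V W) :=
  [set x | exists2 s : seq (V * W),
     forall p, p \in s -> C g p.1 /\ D g p.2 &
     x = \sum_(p <- s) tpure p.1 p.2].

Hypotheses (Csub : forall g, subspace (C g)) (CV : direct_sum C).
Hypotheses (Dsub : forall g, subspace (D g)) (DW : direct_sum D).

Lemma tens_comp_subspace g : subspace (tens_comp g).
Proof.
split; first by exists [::]; rewrite ?big_nil.
move=> a _ _ [s sP ->] [t tP ->].
exists ([seq (a *: p.1, p.2) | p <- s] ++ t).
  move=> p; rewrite mem_cat => /orP[/mapP[q qs ->]|/tP//] /=.
  by have [] := sP q qs; split=> //; apply: subspaceZ.
rewrite big_cat big_map scaler_sumr; congr (_ + _).
by apply: eq_bigr => p _; rewrite scale_tpure.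
Qed.

Let pp g : V -> W -> tens V W :=
  fun v w => tpure (proj Csub CV g v) (proj Dsub DW g w).

Let ppB g : bilin (pp g).
Proof.
split=> *; rewrite /pp ?projD ?projZ.
- exact: tpureDl.
- exact: tpureDr.
- by rewrite scale_tpure.
- by rewrite scale_tpure tpureZ.
Qed.

Lemma tens_comp_proj g h x : tens_comp h x ->
  tlift (pp g) x = if g == h then x else 0.
Proof.
move=> [s sP ->]; rewrite (tlift_sum (ppB g)).
have E p : p \in s -> tlift (pp g) (tpure p.1 p.2) =
                      if g == h then tpure p.1 p.2 else 0.
  move=> /sP[Cp Dp]; rewrite (tlift_pure (ppB g)) /pp.
  rewrite (proj_hom _ _ _ Cp) (proj_hom _ _ _ Dp).
  by case: eqP => // _; apply: tpure0l.
rewrite (eq_big_seq _ E); case: eqP => // _.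
by rewrite big1.
Qed.

Lemma tens_comp_indep : independent tens_comp.
Proof.
move=> s c us Tc c0 g gs.
have := congr1 (tlift (pp g)) c0.
rewrite (tlift_sum (ppB g)) (tlift0 (ppB g)) (bigD1_seq g) //=.
rewrite (tens_comp_proj _ (Tc g)) eqxx big1 ?addr0 // => h hg.
by rewrite (tens_comp_proj _ (Tc h)) eq_sym (negbTE hg).
Qed.

End TensorGrading.

(* That [1] is homogeneous of degree 1, and that the components of a graded
   module are F-subspaces, is not assumed: it follows from the axioms
   ([acomp1] and [mcomp_restr_sub]). *)
Record grAlg (F : fieldType) (G : groupType) := GrAlg {
  galg :> pzAlgType F;
  acomp : G -> set galg;
  acomp_sub : forall g, subspace (acomp g);
  acomp_dsum : direct_sum acomp;
  acompM : forall g h x y,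
    acomp g x -> acomp h y -> acomp (g * h)%g (x * y)
}.

Record grMod (F : fieldType) (G : groupType) (A : grAlg F G) := GrMod {
  gmod :> lmodType A;
  mcomp : G -> set gmod;
  mcomp_sub : forall g, subgroup (mcomp g);
  mcomp_dsum : direct_sum mcomp;
  mcompM : forall g h a w,
    acomp g a -> mcomp h w -> mcomp (g * h)%g (a *: w)
}.

Arguments acomp {F G} _ _ _.
Arguments mcomp {F G A} _ _ _.

Definition strongly_graded (F : fieldType) (G : groupType) (A : grAlg F G) :=
  forall g h : G,
    [set x : A | exists2 s : seq (A * A),
       forall p, p \in s -> acomp A g p.1 /\ acomp A h p.2 &
       x = \sum_(p <- s) p.1 * p.2] = acomp A (g * h)%g.

Definition gr_isomorphic (F : fieldType) (G : groupType) (A B : grAlg F G) :=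
  exists f : {linear A -> B}, [/\ bijective f, f 1 = 1, {morph f : x y / x * y}
    & forall g x, acomp A g x <-> acomp B g (f x)].

Definition finitely_presented (R : pzRingType) (M : lmodType R) : Prop :=
  exists (m n : nat) (f : {linear 'rV[R]_m -> 'rV[R]_n})
         (p : {linear 'rV[R]_n -> M}),
    range p = [set: M] /\ [set x | p x = 0] = range f.

Section GradedTheory.
Variables (F : fieldType) (G : groupType) (A : grAlg F G).

Lemma acomp_subg g : subgroup (acomp A g).
Proof. exact: (@subspace_subgroup F A _ (acomp_sub A g)). Qed.

Lemma acomp_ind (P : A -> Prop) : P 0 -> (forall x y, P x -> P y -> P (x + y)) ->
  (forall g x, acomp A g x -> P x) -> forall x, P x.
Proof.
move=> P0 PD Ph x; apply: (@sum_of_ind _ _ (acomp A)) => //.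
by case: (acomp_dsum A) => ->.
Qed.

Lemma acomp1 : acomp A 1%g 1.
Proof.
have S1 : sum_of (acomp A) 1 by case: (acomp_dsum A) => ->.
have [e [s [us Ae e0 E]]] := sum_ofP acomp_subg S1.
suff <- : e 1%g = 1 by [].
rewrite -[LHS]mul1r.
elim/acomp_ind: (X in X * _ = X) => [|x y IHx IHy|h x Ax].
- by rewrite mul0r.
- by rewrite mulrDl IHx IHy.
have d1 : is_dec (acomp A) x (fun k => x * e (h^-1 * k)%g)
                 [seq (h * k)%g | k <- s].
  split.
  - by rewrite map_inj_uniq //; apply: mulgI.
  - by move=> k; rewrite -[X in acomp A X](mulKg h^-1%g) invgK; apply: acompM.
  - move=> k nk; rewrite e0 ?mulr0 //; apply: contra nk => ks.
    by apply/mapP; exists (h^-1 * k)%g => //; rewrite mulVKg.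
  - rewrite big_map -[LHS]mulr1 {1}E mulr_sumr.
    by apply: eq_bigr => k _; rewrite mulKg.
have := is_dec_uniq acomp_subg (proj2 (acomp_dsum A)) d1
          (is_dec_hom acomp_subg Ax) h.
by rewrite mulVg eqxx.
Qed.

Variable (W : grMod A).

Lemma mcomp_restr_sub g : subspace (mcomp W g : set (restr W)).
Proof.
split=> [|a u v Cu Cv]; first exact: (sg0 (mcomp_sub W)).
apply: (sgD (mcomp_sub W)) => //.
rewrite -[X in mcomp W X](mul1g g); apply: mcompM => //.
by apply: subspaceZ acomp1; apply: acomp_sub.
Qed.

Lemma mcomp_ind (P : W -> Prop) : P 0 -> (forall x y, P x -> P y -> P (x + y)) ->
  (forall g x, mcomp W g x -> P x) -> forall x, P x.
Proof.
move=> P0 PD Ph x; apply: (@sum_of_ind _ _ (mcomp W)) => //.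
by case: (mcomp_dsum W) => ->.
Qed.

End GradedTheory.

(* Independent subspaces B_g of an algebra B with B_g B_h <= B_(g * h) and
   1 in B_1; their sum, [gsub_grAlg] below, is a subalgebra of B graded by
   the B_g. *)
Record gr_family (F : fieldType) (G : groupType) (B : pzAlgType F) := GrFamily {
  fcomp : G -> set B;
  fcomp_sub : forall g, subspace (fcomp g);
  fcomp_indep : independent fcomp;
  fcompM : forall g h x y,
    fcomp g x -> fcomp h y -> fcomp (g * h)%g (x * y);
  fcomp1 : fcomp 1%g 1
}.

Arguments fcomp {F G B} _ _ _.

Section GradedSubalgebra.
Variables (F : fieldType) (G : groupType) (B : pzAlgType F).
Variable (S : gr_family G B).

Let Ssub g : subgroup (fcomp S g).
Proof. exact: (@subspace_subgroup F B _ (fcomp_sub S g)). Qed.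

Definition gsub_pred : pred B := fun x => `[< sum_of (fcomp S) x >].

Lemma gsub_predE x : (x \in gsub_pred) = `[< sum_of (fcomp S) x >].
Proof. by []. Qed.

Lemma gsub_pred_subring : subring_closed gsub_pred.
Proof.
have [S0 SB] := sum_of_subgroup Ssub.
split.
- by apply/asboolP/(sum_of_hom Ssub); apply: fcomp1.
- by move=> x y /asboolP Sx /asboolP Sy; apply/asboolP/SB.
- move=> x y /asboolP Sx /asboolP Sy; apply/asboolP.
  elim/(sum_of_ind (C := fcomp S)): Sx => [|x1 x2 IH1 IH2|g x1 Sx].
  + by rewrite mul0r.
  + by rewrite mulrDl; apply: (sum_ofD Ssub).
  elim/(sum_of_ind (C := fcomp S)): Sy => [|y1 y2 IH1 IH2|h y1 Sy].
  + by rewrite mulr0.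
  + by rewrite mulrDr; apply: (sum_ofD Ssub).
  by apply: (sum_of_hom Ssub); apply: fcompM Sx Sy.
Qed.

HB.instance Definition _ := GRing.isSubringClosed.Build B gsub_pred
  gsub_pred_subring.

Lemma gsub_predZ (a : F) x : x \in gsub_pred -> a *: x \in gsub_pred.
Proof.
move=> /asboolP Sx; apply/asboolP.
elim/(sum_of_ind (C := fcomp S)): Sx => [|x1 x2 IH1 IH2|g x1 Sx].
- by rewrite scaler0; apply: (sum_of_subgroup Ssub).1.
- by rewrite scalerDr; apply: (sum_ofD Ssub).
by apply: (sum_of_hom Ssub); apply: subspaceZ Sx; apply: fcomp_sub.
Qed.

Definition gsub : Type := {x : B | x \in gsub_pred}.

HB.instance Definition _ := SubChoice.on gsub.
HB.instance Definition _ := 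
  GRing.SubChoice_isSubPzRing.Build B gsub_pred gsub gsub_pred_subring.

Definition gsub_scale (a : F) (x : gsub) : gsub :=
  exist _ (a *: val x) (gsub_predZ a (valP x)).

Lemma gsub_scaleA a b x : gsub_scale a (gsub_scale b x) = gsub_scale (a * b) x.
Proof. by apply: val_inj; rewrite /= scalerA. Qed.

Lemma gsub_scale1 : left_id 1 gsub_scale.
Proof. by move=> x; apply: val_inj; rewrite /= scale1r. Qed.

Lemma gsub_scaleDr : right_distributive gsub_scale +%R.
Proof. by move=> a x y; apply: val_inj; rewrite /= scalerDr. Qed.

Lemma gsub_scaleDl x : {morph gsub_scale^~ x : a b / a + b}.
Proof. by move=> a b; apply: val_inj; rewrite /= scalerDl. Qed.

HB.instance Definition _ := GRing.Zmodule_isLmodule.Build F gsub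
  gsub_scaleA gsub_scale1 gsub_scaleDr gsub_scaleDl.

Lemma gsub_scaleAl a (x y : gsub) : gsub_scale a (x * y) = gsub_scale a x * y.
Proof. by apply: val_inj; rewrite /= pzscalerAl. Qed.

Lemma gsub_scaleAr a (x y : gsub) : gsub_scale a (x * y) = x * gsub_scale a y.
Proof. by apply: val_inj; rewrite /= pzscalerAr. Qed.

HB.instance Definition _ := PzRing_isPzAlgebra.Build F gsub
  gsub_scaleA gsub_scale1 gsub_scaleDr gsub_scaleDl gsub_scaleAl gsub_scaleAr.

Definition gsub_comp (g : G) : set gsub := [set x | fcomp S g (val x)].

Lemma gsub_comp_sub g : subspace (gsub_comp g).
Proof.
have [S0 SD] := fcomp_sub S g.
by split=> // a u v; apply: SD.
Qed.

Lemma gsub_comp_dsum : direct_sum gsub_comp.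
Proof.
split.
  apply/seteqP; split=> // x _.
  have /asboolP[s [c [us Sc E]]] := valP x.
  have cP g : c g \in gsub_pred by apply/asboolP/(sum_of_hom Ssub (Sc g)).
  exists s, (fun g => exist _ (c g) (cP g) : gsub); split=> //.
  by apply: val_inj; rewrite E raddf_sum.
move=> s c us Sc c0 g gs; apply: val_inj.
apply: (fcomp_indep us Sc _ gs).
by rewrite -(raddf_sum (val : gsub -> B)) c0.
Qed.

Lemma gsub_compM g h x y :
  gsub_comp g x -> gsub_comp h y -> gsub_comp (g * h)%g (x * y).
Proof. exact: fcompM. Qed.

Definition gsub_grAlg : grAlg F G :=
  GrAlg gsub_comp_sub gsub_comp_dsum gsub_compM.

End GradedSubalgebra.

Section GradedTensorAlgebra.
Variables (F : fieldType) (G : groupType) (A A' : grAlg F G).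

Lemma tens_acompM g h (x y : tens A A') :
  tens_comp (acomp A) (acomp A') g x -> tens_comp (acomp A) (acomp A') h y ->
  tens_comp (acomp A) (acomp A') (g * h)%g (x * y).
Proof.
move=> [s sP ->] [t tP ->].
exists [seq (p.1 * q.1, p.2 * q.2) | p <- s, q <- t].
  move=> _ /allpairsP[[p q] [ps qt ->]] /=.
  have [] := sP _ ps; have [] := tP _ qt.
  by split; apply: acompM.
rewrite mulr_suml big_allpairs_dep; apply: eq_bigr => p _.
rewrite mulr_sumr; apply: eq_bigr => q _.
exact: tens_mul_pure.
Qed.

Lemma tens_acomp1 : tens_comp (acomp A) (acomp A') 1%g 1.
Proof.
exists [:: (1, 1)]; last by rewrite big_seq1.
by move=> p; rewrite inE => /eqP ->; split; apply: acomp1.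
Qed.

Lemma tens_acomp_sub g : subspace (tens_comp (acomp A) (acomp A') g).
Proof. by apply: tens_comp_subspace; apply: acomp_sub. Qed.

Lemma tens_acomp_indep : independent (tens_comp (acomp A) (acomp A')).
Proof.
by apply: tens_comp_indep; [apply: acomp_sub | apply: acomp_dsum
                           | apply: acomp_sub | apply: acomp_dsum].
Qed.

Definition tens_family : gr_family G (tens A A') :=
  GrFamily tens_acomp_sub tens_acomp_indep tens_acompM tens_acomp1.

Definition gr_tens : grAlg F G := gsub_grAlg tens_family.

End GradedTensorAlgebra.

Section GradedTensorModule.
Variables (F : fieldType) (G : groupType) (A A' : grAlg F G).
Variables (W : grMod A) (W' : grMod A').

Definition tens_mcomp : G -> set (tens (restr W) (restr W')) :=
  tens_comp (mcomp W : G -> set (restr W)) (mcomp W' : G -> set (restr W')).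

Lemma tens_mcomp_sub g : subspace (tens_mcomp g).
Proof. by apply: tens_comp_subspace; apply: mcomp_restr_sub. Qed.

Lemma tens_mcomp_subg g : subgroup (tens_mcomp g).
Proof. exact: subspace_subgroup (tens_mcomp_sub g). Qed.

Lemma tens_mcomp_indep : independent tens_mcomp.
Proof.
apply: tens_comp_indep; [exact: mcomp_restr_sub | exact: mcomp_dsum
                         |exact: mcomp_restr_sub | exact: mcomp_dsum].
Qed.

Definition tens_act : tens A A' -> tens (restr W) (restr W') ->
    tens (restr W) (restr W') :=
  tmap2 (fun (a : A) (w : restr W) => (a *: (w : W)) : restr W)
        (fun (a : A') (w : restr W') => (a *: (w : W')) : restr W').

Lemma bilin_act (B : pzAlgType F) (M : lmodType B) :
  bilin (fun (a : B) (w : restr M) => (a *: (w : M)) : restr M).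
Proof.
split.
- by move=> a b w; exact: (@scalerDl B M).
- by move=> a u v; exact: (@scalerDr B M).
- move=> a b w; change ((a *: b) *: (w : M) = (a *: (1 : B)) *: (b *: (w : M))).
  by rewrite scalerA -pzscalerAl mul1r.
- move=> a b w; change (b *: ((a *: (1 : B)) *: (w : M)) =
                        (a *: (1 : B)) *: (b *: (w : M))).
  by rewrite !scalerA -pzscalerAl -pzscalerAr mul1r mulr1.
Qed.

Lemma bilin_tens_act : bilin tens_act.
Proof. by apply: bilin_tmap2; apply: bilin_act. Qed.

Lemma tens_act_pure a a' w w' :
  tens_act (tpure a a') (tpure w w') =
  tpure ((a *: (w : W)) : restr W) ((a' *: (w' : W')) : restr W').
Proof. by apply: tmap2_pure; apply: bilin_act. Qed.

Let m0l := bilin0l bilin_tens_act.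
Let m0r x : tens_act x 0 = 0.
Proof.
have := bilin_sumr bilin_tens_act [::] x (fun _ : unit => 0).
by rewrite !big_nil.
Qed.
Let mD := bilinDl bilin_tens_act.
Let mDr := bilinDr bilin_tens_act.

Lemma tens_actA x y w : tens_act x (tens_act y w) = tens_act (x * y) w.
Proof.
elim/tens_ind: x => [|x x' IH IH'|a a']; first by rewrite mul0r !m0l.
  by rewrite mulrDl !mD IH IH'.
elim/tens_ind: y => [|y y' IH IH'|b b']; first by rewrite mulr0 !(m0l, m0r).
  by rewrite mulrDr !(mD, mDr) IH IH'.
elim/tens_ind: w => [|w w' IH IH'|w w']; first by rewrite !m0r.
  by rewrite !mDr IH IH'.
rewrite [_ * _]tens_mul_pure !tens_act_pure.
by rewrite -!scalerA.
Qed.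

Lemma tens_act1 w : tens_act 1 w = w.
Proof.
elim/tens_ind: w => [|w w' IH IH'|w w']; first by rewrite m0r.
  by rewrite mDr IH IH'.
by rewrite tens_act_pure !scale1r.
Qed.

Lemma tens_mcompM g h (x : tens A A') w :
  tens_comp (acomp A) (acomp A') g x -> tens_mcomp h w ->
  tens_mcomp (g * h)%g (tens_act x w).
Proof.
move=> [s sP ->] [t tP ->].
exists [seq ((p.1 *: (q.1 : W)) : restr W, (p.2 *: (q.2 : W')) : restr W')
       | p <- s, q <- t].
  move=> _ /allpairsP[[p q] [ps qt ->]] /=.
  have [] := sP _ ps; have [] := tP _ qt.
  by split; apply: mcompM.
rewrite (bilin_suml bilin_tens_act) big_allpairs_dep; apply: eq_bigr => p _.
rewrite (bilin_sumr bilin_tens_act); apply: eq_bigr => q _.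
exact: tens_act_pure.
Qed.

Definition tensM_pred : pred (tens (restr W) (restr W')) :=
  fun x => `[< sum_of tens_mcomp x >].

Lemma tensM_pred_zmod : zmod_closed tensM_pred.
Proof.
have [S0 SB] := sum_of_subgroup tens_mcomp_subg.
split; first by apply/asboolP.
by move=> x y /asboolP Sx /asboolP Sy; apply/asboolP/SB.
Qed.

HB.instance Definition _ := GRing.isZmodClosed.Build _ tensM_pred
  tensM_pred_zmod.

Definition tensM : Type := {x | x \in tensM_pred}.

HB.instance Definition _ := SubChoice.on tensM.
HB.instance Definition _ := [SubChoice_isSubZmodule of tensM by <:].

Lemma tensM_act_subproof (x : gr_tens A A') (w : tensM) :
  tens_act (val x) (val w) \in tensM_pred.
Proof.
have := valP w; have := valP x => /asboolP Sx /asboolP Sw; apply/asboolP.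
have subg := sum_of_subgroup tens_mcomp_subg.
elim/(sum_of_ind (C := fcomp (tens_family A A'))): Sx => [|x1 x2 IH IH'|g x1 Sx].
- by rewrite m0l; case: subg.
- by rewrite mD; apply: (sum_ofD tens_mcomp_subg).
elim/(sum_of_ind (C := tens_mcomp)): Sw => [|y1 y2 IH IH'|h y1 Sy].
- by rewrite m0r; case: subg.
- by rewrite mDr; apply: (sum_ofD tens_mcomp_subg).
by apply: (sum_of_hom tens_mcomp_subg); apply: tens_mcompM Sx Sy.
Qed.

Definition tensM_act (x : gr_tens A A') (w : tensM) : tensM :=
  exist _ (tens_act (val x) (val w)) (tensM_act_subproof x w).

Lemma tensM_actA x y w : tensM_act x (tensM_act y w) = tensM_act (x * y) w.
Proof. by apply: val_inj; apply: tens_actA. Qed.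

Lemma tensM_act1 : left_id 1 tensM_act.
Proof. by move=> w; apply: val_inj; apply: tens_act1. Qed.

Lemma tensM_actDr : right_distributive tensM_act +%R.
Proof. by move=> x u v; apply: val_inj; apply: mDr. Qed.

Lemma tensM_actDl w : {morph tensM_act^~ w : x y / x + y}.
Proof. by move=> x y; apply: val_inj; apply: mD. Qed.

HB.instance Definition _ := GRing.Zmodule_isLmodule.Build (gr_tens A A') tensM
  tensM_actA tensM_act1 tensM_actDr tensM_actDl.

Definition tensM_comp (g : G) : set tensM := [set w | tens_mcomp g (val w)].

Lemma tensM_comp_sub g : subgroup (tensM_comp g).
Proof.
have [S0 SB] := tens_mcomp_subg g.
by split=> // u v; apply: SB.
Qed.

Lemma tensM_comp_dsum : direct_sum tensM_comp.
Proof.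
split.
  apply/seteqP; split=> // x _.
  have /asboolP[s [c [us Sc E]]] := valP x.
  have cP g : c g \in tensM_pred.
    by apply/asboolP/(sum_of_hom tens_mcomp_subg (Sc g)).
  exists s, (fun g => exist _ (c g) (cP g) : tensM); split=> //.
  by apply: val_inj; rewrite E raddf_sum.
move=> s c us Sc c0 g gs; apply: val_inj.
apply: (tens_mcomp_indep us Sc _ gs).
by rewrite -(raddf_sum (val : tensM -> _)) c0.
Qed.

Lemma tensM_compM g h (x : gr_tens A A') (w : tensM) :
  acomp (gr_tens A A') g x -> tensM_comp h w -> tensM_comp (g * h)%g (x *: w).
Proof. exact: tens_mcompM. Qed.

Definition gr_tensM : grMod (gr_tens A A') :=
  GrMod tensM_comp_sub tensM_comp_dsum tensM_compM.

End GradedTensorModule.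

(* Endomorphisms act from the right: [phi * psi] is [psi \o phi]. *)
Section Endomorphisms.
Variables (F : fieldType) (A : pzAlgType F) (W : lmodType A).

Definition rEnd : Type := {linear W -> W}.
Definition rEnd_fun (phi : rEnd) : W -> W := (phi : {linear W -> W}).
Coercion rEnd_fun : rEnd >-> Funclass.

HB.instance Definition _ := gen_eqMixin rEnd.
HB.instance Definition _ := gen_choiceMixin rEnd.

Lemma rEndP (phi psi : rEnd) : phi =1 psi -> phi = psi.
Proof.
case: phi psi => f [x y] [g [x' y']] fg.
have E : f = g by apply/funext => w; exact: fg w.
subst g; case: x {fg} => -[a b]; case: x' => -[a' b']; case: y => c; case: y' => c'.
by rewrite (Prop_irrelevance a a') (Prop_irrelevance b b')
           (Prop_irrelevance c c').
Qed.

Lemma rEnd_linear (phi : rEnd) : linear phi.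
Proof. by move=> a u v; rewrite /rEnd_fun linearP. Qed.

Definition rEnd_zero : rEnd := (\0 : {linear W -> W}).
Definition rEnd_opp (phi : rEnd) : rEnd :=
  (\- (phi : {linear W -> W}) : {linear W -> W}).
Definition rEnd_add (phi psi : rEnd) : rEnd :=
  ((phi : {linear W -> W}) \+ (psi : {linear W -> W}) : {linear W -> W}).
Definition rEnd_one : rEnd := (idfun : {linear W -> W}).
Definition rEnd_mul (phi psi : rEnd) : rEnd :=
  ((psi : {linear W -> W}) \o (phi : {linear W -> W}) : {linear W -> W}).

Lemma rEnd0 (phi : rEnd) : phi 0 = 0.
Proof. by rewrite /rEnd_fun linear0. Qed.
Lemma rEndD (phi : rEnd) u v : phi (u + v) = phi u + phi v.
Proof. by rewrite /rEnd_fun linearD. Qed.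
Lemma rEndZ (phi : rEnd) a u : phi (a *: u) = a *: phi u.
Proof. by rewrite /rEnd_fun linearZ. Qed.

Lemma rEnd_addA : associative rEnd_add.
Proof. by move=> f g h; apply: rEndP => x; apply: addrA. Qed.
Lemma rEnd_addC : commutative rEnd_add.
Proof. by move=> f g; apply: rEndP => x; apply: addrC. Qed.
Lemma rEnd_add0 : left_id rEnd_zero rEnd_add.
Proof. by move=> f; apply: rEndP => x; apply: add0r. Qed.
Lemma rEnd_addN : left_inverse rEnd_zero rEnd_opp rEnd_add.
Proof. by move=> f; apply: rEndP => x; apply: addNr. Qed.

HB.instance Definition _ :=
  GRing.isZmodule.Build rEnd rEnd_addA rEnd_addC rEnd_add0 rEnd_addN.

Lemma rEnd_mulA : associative rEnd_mul.
Proof. by move=> f g h; apply: rEndP. Qed.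
Lemma rEnd_mul1 : left_id rEnd_one rEnd_mul.
Proof. by move=> f; apply: rEndP. Qed.
Lemma rEnd_mulr1 : right_id rEnd_one rEnd_mul.
Proof. by move=> f; apply: rEndP. Qed.
Lemma rEnd_mulDl : left_distributive rEnd_mul +%R.
Proof. by move=> f g h; apply: rEndP => x; apply: (rEndD h). Qed.
Lemma rEnd_mulDr : right_distributive rEnd_mul +%R.
Proof. by move=> f g h; apply: rEndP. Qed.

HB.instance Definition _ := GRing.Zmodule_isPzRing.Build rEnd
  rEnd_mulA rEnd_mul1 rEnd_mulr1 rEnd_mulDl rEnd_mulDr.

Lemma rEnd_scale_linear (a : F) (phi : rEnd) :
  linear (fun w => (a *: (1 : A)) *: phi w).
Proof.
move=> b u v; rewrite rEndD rEndZ scalerDr; congr (_ + _).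
by rewrite !scalerA -pzscalerAl -pzscalerAr mul1r mulr1.
Qed.

Definition rEnd_scale (a : F) (phi : rEnd) : rEnd :=
  HB.pack_for {linear W -> W} (fun w => (a *: (1 : A)) *: phi w)
    (GRing.isLinear.Build A W W _ _ (rEnd_scale_linear a phi)).

Lemma rEnd_scaleE a (phi : rEnd) w : rEnd_scale a phi w = (a *: (1 : A)) *: phi w.
Proof. by []. Qed.

Lemma rEnd_scaleA a b phi :
  rEnd_scale a (rEnd_scale b phi) = rEnd_scale (a * b) phi.
Proof.
apply: rEndP => w; rewrite !rEnd_scaleE scalerA.
by rewrite -pzscalerAl mul1r scalerA.
Qed.
Lemma rEnd_scale1 : left_id 1 rEnd_scale.
Proof. by move=> f; apply: rEndP => w; rewrite rEnd_scaleE !scale1r. Qed.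
Lemma rEnd_scaleDr : right_distributive rEnd_scale +%R.
Proof. by move=> a f g; apply: rEndP => w; apply: scalerDr. Qed.
Lemma rEnd_scaleDl f : {morph rEnd_scale^~ f : a b / a + b}.
Proof.
by move=> a b; apply: rEndP => w; rewrite rEnd_scaleE !scalerDl.
Qed.

HB.instance Definition _ := GRing.Zmodule_isLmodule.Build F rEnd
  rEnd_scaleA rEnd_scale1 rEnd_scaleDr rEnd_scaleDl.

Lemma rEnd_scaleAl a (f g : rEnd) : rEnd_scale a (f * g) = rEnd_scale a f * g.
Proof. by apply: rEndP => w; apply: esym (rEndZ g _ _). Qed.
Lemma rEnd_scaleAr a (f g : rEnd) : rEnd_scale a (f * g) = f * rEnd_scale a g.
Proof. by apply: rEndP. Qed.

HB.instance Definition _ := PzRing_isPzAlgebra.Build F rEnd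
  rEnd_scaleA rEnd_scale1 rEnd_scaleDr rEnd_scaleDl rEnd_scaleAl rEnd_scaleAr.

Lemma rEnd_sum I (s : seq I) (c : I -> rEnd) w :
  (\sum_(i <- s) c i) w = \sum_(i <- s) c i w.
Proof.
elim: s => [|i s IHs]; first by rewrite !big_nil.
by rewrite !big_cons -IHs.
Qed.

End Endomorphisms.

Section GradedEndomorphisms.
Variables (F : fieldType) (G : groupType) (A : grAlg F G) (W : grMod A).

Definition rEnd_comp (g : G) : set (rEnd W) :=
  [set phi | forall h w, mcomp W h w -> mcomp W (h * g)%g (phi w)].

Lemma rEnd_comp_sub g : subspace (rEnd_comp g).
Proof.
split=> [h w _|a f f' Pf Pf' h w Ww]; first exact: (sg0 (mcomp_sub W)).
apply: (sgD (mcomp_sub W)); last exact: Pf'.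
exact: (subspaceZ (mcomp_restr_sub W _) a (Pf h w Ww)).
Qed.

Lemma rEnd_comp_indep : independent rEnd_comp.
Proof.
move=> s c us Pc c0 g gs; apply: rEndP => w.
elim/(@mcomp_ind _ _ _ W): w => [|u v IHu IHv|h w Ww].
- by rewrite rEnd0.
- by rewrite rEndD IHu IHv addr0.
have us' : uniq [seq (h * k)%g | k <- s].
  by rewrite map_inj_uniq //; apply: mulgI.
have Wc k : mcomp W k (c (h^-1 * k)%g w).
  by rewrite -[X in mcomp W X](mulVKg h); apply: Pc.
have := (proj2 (mcomp_dsum W)) _ _ us' Wc _ (h * g)%g (map_f _ gs).
rewrite /= mulKg; apply.
rewrite big_map (eq_bigr (fun k => c k w)) => [|k _]; last by rewrite mulKg.
by rewrite -rEnd_sum c0.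
Qed.

Lemma rEnd_compM g h (f f' : rEnd W) :
  rEnd_comp g f -> rEnd_comp h f' -> rEnd_comp (g * h)%g (f * f').
Proof. by move=> Pf Pf' k w Ww; rewrite mulgA; apply: Pf'; apply: Pf. Qed.

Lemma rEnd_comp1 : rEnd_comp 1%g 1.
Proof. by move=> h w Ww; rewrite mulg1. Qed.

Definition rEnd_family : gr_family G (rEnd W) :=
  GrFamily rEnd_comp_sub rEnd_comp_indep rEnd_compM rEnd_comp1.

Definition gr_rEnd : grAlg F G := gsub_grAlg rEnd_family.

End GradedEndomorphisms.

(* Main.v *)
Require Import Defs.
From HB Require Import structures.
From mathcomp Require Import all_boot all_algebra.
From mathcomp Require Import boolp classical_sets.

Set Implicit Arguments.
Unset Strict Implicit.
Unset Printing Implicit Defensive.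

Import GRing.Theory.
Local Open Scope classical_set_scope.
Local Open Scope ring_scope.

(** Write [E] and [E'] for the two graded endomorphism algebras.  The
    isomorphism is the obvious one: an element of [E] tensor [E'] acts on the
    tensor product of the modules over F by [tens_endo], factor by factor.  A
    homogeneous element preserves the graded product of the modules and shifts
    degrees there by its own degree, and the action commutes with that of the
    algebras, so it restricts to the morphism [comparison] of graded algebras.
    What has to be shown is that [comparison] is bijective.

    Strong grading brings everything down to degree 1.  As 1 is a sum of
    products of elements of A_g and A_(g^-1), every element of a graded module
    is an A-combination of elements of degree 1 ([strongly_graded_span]).  This
    applies to W and also to the module of relations between finitely many
    generators of degree 1; as a finite presentation survives a change of
    generators, W has a finite presentation with generators u_i of degree 1 and
    relations whose coefficients b_ki have degree 1 ([graded_presentation]).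
    Hence an endomorphism of W of degree g is the same thing as a vector
    (v_i) of elements of W_g with sum_i b_ki v_i = 0 for all k, its values
    at the u_i ([rEnd_extend]).  Such vectors form the kernel of an F-linear map
    [relmap] on W^n.

    The rest is linear algebra over F, where every linear map g has a linear
    generalized inverse h, g h g = g ([linear_regular]).  Two exactness
    properties of the tensor product follow: the tensor product of injective
    maps is injective ([tmap_inj0]), and an element of V tensor V' killed by
    f tensor id and by id tensor f' is a sum of pure tensors of elements of
    ker f and ker f' ([tmap_ker]).

    Injectivity ([comparison_ker]): evaluation at the generators embeds E into
    W^n and E' into W'^n', hence their tensor product into the tensor product
    of W^n and W'^n', and the coordinates of the image of x are the values
    of [comparison x] at the u_i tensor u'_j.

    Surjectivity ([comparison_surj]): for theta of degree g, the values of theta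
    at the u_i tensor u'_j are the coordinates of an element of the tensor
    product of W^n and W'^n'.  Because theta is linear over the graded product
    of the algebras, which contains b_ki tensor 1 and 1 tensor b'_kj, this
    element is killed by both relation maps; it is therefore a sum of pure
    tensors of vectors that are the values of endomorphisms of degree g.  The
    sum of the tensors of these endomorphisms is sent to theta, because the
    u_i tensor u'_j generate the graded product of the modules ([gr_tensM_span]). *)

(** * Linear maps and tensor products over a field *)

Section LinearAlgebra.
Variable F : fieldType.

Section LinearFunction.
Variables (V W : lmodType F) (f : V -> W).
Hypothesis fL : linear f.

Lemma lin0 : f 0 = 0.
Proof. by have := fL (-1) 0 0; rewrite scaler0 addr0 scaleN1r addNr. Qed.

Lemma linD u v : f (u + v) = f u + f v.
Proof. by have := fL 1 u v; rewrite !scale1r. Qed.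

Lemma linZ a u : f (a *: u) = a *: f u.
Proof. by rewrite -[a *: u]addr0 fL lin0 addr0. Qed.

Lemma linB u v : f (u - v) = f u - f v.
Proof. by rewrite linD -scaleN1r linZ scaleN1r. Qed.

Lemma lin_sum I (r : seq I) (v : I -> V) :
  f (\sum_(i <- r) v i) = \sum_(i <- r) f (v i).
Proof. exact: (big_morph f linD lin0). Qed.

End LinearFunction.

Lemma tpure0r (V W : lmodType F) (v : V) : tpure v (0 : W) = 0.
Proof. by rewrite -(scale0r (0 : W)) -tpureZ scale0r tpure0l. Qed.

Lemma subspaceN (V : lmodType F) (S : set V) u : subspace S -> S u -> S (- u).
Proof. by move=> SS Su; rewrite -scaleN1r; apply: subspaceZ. Qed.

(** By Zorn's lemma: a maximal M among the subsets closed under linear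
    combinations that meet S in 0 at most.  The empty set is such a subset, so
    that the union of the empty chain causes no trouble. *)
Lemma subspace_complement (V : lmodType F) (S : set V) : subspace S ->
  exists M : set V, [/\ subspace M, S `&` M `<=` [set 0] &
    forall x, exists2 s, S s & exists2 m, M m & x = s + m].
Proof.
move=> SS.
pose lc (A : set V) := forall (a : F) u v, A u -> A v -> A (a *: u + v).
pose P (A : set V) := lc A /\ S `&` A `<=` [set 0].
have [|M [[Ml MS] Mmax]] := @Zorn_bigcup V P.
  move=> C CP Ctot; split=> [a u v [A CA Au] [B CB Bv]|u [Su [A CA Au]]].
    have [AB|BA] := Ctot A B CA CB.
      by exists B => //; apply: (CP _ CB).1 => //; apply: AB.
    by exists A => //; apply: (CP _ CA).1 => //; apply: BA.
  exact: (CP _ CA).2.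
have maxM (B : set V) : M `<=` B -> P B -> B `<=` M.
  move=> MB PB; have [//|nBM] := pselect (B `<=` M).
  by case: (Mmax B).
(* an empty M would be contained in {0} *)
have M0 : M 0.
  have [[u Mu]|nM] := pselect (exists u, M u).
    by rewrite -(addNr u) -scaleN1r; apply: Ml.
  apply: (maxM [set 0]) => // [u Mu|]; first by case: nM; exists u.
  split=> [a u v -> ->|u [_ //]].
  by rewrite /= scaler0 addr0.
have MZ a m : M m -> M (a *: m) by move=> Mm; rewrite -[_ *: _]addr0; apply: Ml.
exists M; split=> // x.
(* if no element of S has a nonzero component along x modulo M, then x can be
   adjoined to M, so x is in M already *)
pose B := [set y | exists2 m, M m & exists a, y = m + a *: x].
have [[s [m [a [Ss Mm a0 E]]]]|nE] := pselect (exists s m a,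
    [/\ S s, M m, a != 0 & s = m + a *: x]).
  exists (a^-1 *: s); first exact: subspaceZ.
  exists (- a^-1 *: m); first exact: MZ.
  by rewrite E scalerDr scalerA mulVf // scale1r scaleNr addrC addKr.
exists 0; first by case: SS.
exists x; last by rewrite add0r.
apply: (maxM B) => [m Mm||]; last 1 first.
- by exists 0 => //; exists 1; rewrite add0r scale1r.
- by exists m => //; exists 0; rewrite scale0r addr0.
split=> [c _ _ [m Mm [a ->]] [m' Mm' [a' ->]]|y [Ss [m Mm [a E]]]].
  exists (c *: m + m'); first exact: Ml.
  by exists (c * a + a'); rewrite scalerDr scalerDl scalerA addrACA.
have [a0|a0] := eqVneq a 0.
  by apply: MS; split=> //; rewrite E a0 scale0r addr0.
by case: nE; exists (m + a *: x), m, a; split=> //; rewrite -E.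
Qed.

(** With M a complement of ker g and N a complement of im g, g maps M
    bijectively onto im g; h is the inverse of this bijection, extended by 0 on
    N.  Equivalently, h y is the unique m in M with y - g m in N. *)
Lemma linear_regular (V W : lmodType F) (g : V -> W) : linear g ->
  exists2 h : W -> V, linear h & forall v, g (h (g v)) = g v.
Proof.
move=> gL.
have kerS : subspace [set v | g v = 0].
  split=> [|a u v /= gu gv]; first exact: lin0.
  by rewrite gL gu gv scaler0 addr0.
have imS : subspace (range g).
  split=> [|a _ _ [u _ <-] [v _ <-]]; first by exists 0; rewrite ?lin0.
  by exists (a *: u + v); rewrite ?gL.
have [M [[M0 ML] MS Mdec]] := subspace_complement kerS.
have [N [[N0 NL] NS Ndec]] := subspace_complement imS.
pose R y m := M m /\ N (y - g m).
have Rex y : exists m, R y m.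
  have [_ [v _ <-] [n Nn ->]] := Ndec y; have [k gk [m Mm ->]] := Mdec v.
  by exists m; split=> //; rewrite linD // (gk : g k = 0) add0r addrC addKr.
have R0 m : R 0 m -> m = 0.
  rewrite /R sub0r => -[Mm /(subspaceN (conj N0 NL))]; rewrite opprK => Ngm.
  by apply: MS; split=> //; apply: NS; split=> //; exists m.
have RL a y z m m' : R y m -> R z m' -> R (a *: y + z) (a *: m + m').
  move=> [Mm Ny] [Mm' Nz]; split; first exact: ML.
  by rewrite gL opprD addrACA -scalerBr; apply: NL.
have Runiq y m m' : R y m -> R y m' -> m = m'.
  move=> Rm Rm'; have := RL (-1) _ _ _ _ Rm Rm'.
  by rewrite !scaleN1r addNr addrC => /R0/eqP; rewrite subr_eq0 => /eqP.
have [h hR] := choice Rex; exists h.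
  move=> a y z; apply: (Runiq (a *: y + z)) => //.
  exact: RL.
move=> v; have [Mh Nh] := hR (g v); apply/eqP; rewrite eq_sym -subr_eq0.
by apply/eqP/NS; split=> //; exists (v - h (g v)); rewrite ?linB.
Qed.

Section TensorOfMaps.
Variables (V1 V2 W1 W2 : lmodType F) (f : V1 -> V2) (g : W1 -> W2).

Definition tmap : tens V1 W1 -> tens V2 W2 :=
  tlift (fun v w => tpure (f v) (g w)).

Hypotheses (fL : linear f) (gL : linear g).

Lemma bilin_tmap : bilin (fun v w => tpure (f v) (g w)).
Proof.
split=> *; rewrite ?(linD fL) ?(linD gL) ?(linZ fL) ?(linZ gL).
- exact: tpureDl.
- exact: tpureDr.
- by rewrite scale_tpure.
- by rewrite scale_tpure tpureZ.
Qed.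

Lemma tmap_pure v w : tmap (tpure v w) = tpure (f v) (g w).
Proof. exact: (tlift_pure bilin_tmap). Qed.

Lemma tmap_linear : linear tmap.
Proof.
by move=> a x y; rewrite /tmap (tliftD bilin_tmap) (tliftZ bilin_tmap).
Qed.

Lemma tmap_sum_pure (s : seq (V1 * W1)) :
  tmap (\sum_(p <- s) tpure p.1 p.2) = \sum_(p <- s) tpure (f p.1) (g p.2).
Proof.
by rewrite (lin_sum tmap_linear); apply: eq_bigr => p _; rewrite tmap_pure.
Qed.

End TensorOfMaps.

(** Pure tensors span; all identities between maps on tensor products below are
    obtained in this way. *)
Lemma linear_eq_tens (V W U : lmodType F) (f g : tens V W -> U) :
  linear f -> linear g -> (forall v w, f (tpure v w) = g (tpure v w)) -> f =1 g.
Proof.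
move=> fL gL fg x; elim/tens_ind: x => [|x y IHx IHy|//].
  by rewrite !lin0.
by rewrite !linD // IHx IHy.
Qed.

Lemma linear_id (V : lmodType F) : linear (@id V).
Proof. by []. Qed.

Lemma linear_comp (V W U : lmodType F) (f : V -> W) (g : W -> U) :
  linear f -> linear g -> linear (g \o f).
Proof. by move=> fL gL a u v /=; rewrite fL gL. Qed.

Lemma linear_sub (V W : lmodType F) (f g : V -> W) :
  linear f -> linear g -> linear (f \- g).
Proof. by move=> fL gL a u v /=; rewrite fL gL scalerBr opprD addrACA. Qed.

Lemma tmap_comp (V1 V2 V3 W1 W2 W3 : lmodType F) (f : V1 -> V2) (f' : V2 -> V3)
    (g : W1 -> W2) (g' : W2 -> W3) :
  linear f -> linear f' -> linear g -> linear g' ->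
  forall x, tmap f' g' (tmap f g x) = tmap (f' \o f) (g' \o g) x.
Proof.
move=> fL fL' gL gL'.
have fL2 := linear_comp fL fL'; have gL2 := linear_comp gL gL'.
apply: linear_eq_tens => [||v w]; last by rewrite !tmap_pure.
  by apply: (@linear_comp _ _ _ (tmap f g) (tmap f' g')); apply: tmap_linear.
exact: tmap_linear.
Qed.

Lemma tmap_idP (V W : lmodType F) (f : V -> V) (g : W -> W) :
  f =1 id -> g =1 id -> forall x, tmap f g x = x.
Proof.
move=> /funext -> /funext ->.
apply: linear_eq_tens => [||v w]; [exact: tmap_linear| by [] |].
by rewrite tmap_pure //; apply: linear_id.
Qed.

Lemma tmap_subl (V V' W W' : lmodType F) (f f' : V -> V') (g : W -> W') :
  linear f -> linear f' -> linear g ->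
  forall x, tmap (f \- f') g x = tmap f g x - tmap f' g x.
Proof.
move=> fL fL' gL; have ffL := linear_sub fL fL'.
apply: linear_eq_tens => [||v w]; first exact: tmap_linear.
  by apply: linear_sub; apply: tmap_linear.
rewrite !tmap_pure // (linB (f := fun u => tpure u (g w))) // => a u u'.
by rewrite tpureDl scale_tpure.
Qed.

Lemma tmap_subr (V V' W W' : lmodType F) (f : V -> V') (g g' : W -> W') :
  linear f -> linear g -> linear g' ->
  forall x, tmap f (g \- g') x = tmap f g x - tmap f g' x.
Proof.
move=> fL gL gL'; have ggL := linear_sub gL gL'.
apply: linear_eq_tens => [||v w]; first exact: tmap_linear.
  by apply: linear_sub; apply: tmap_linear.
rewrite !tmap_pure // (linB (f := tpure (f v))) // => a u u'.
by rewrite tpureDr scale_tpure tpureZ.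
Qed.

(** With h and k generalized inverses of f and g, the maps 1 - h f and 1 - k g
    have their values in ker f and ker g, and their tensor product fixes x. *)
Lemma tmap_ker (V V' W W' : lmodType F) (f : V -> V') (g : W -> W') :
  linear f -> linear g ->
  forall x, tmap f id x = 0 -> tmap id g x = 0 ->
  exists2 s : seq (V * W), (forall p, p \in s -> f p.1 = 0 /\ g p.2 = 0) &
    x = \sum_(p <- s) tpure p.1 p.2.
Proof.
move=> fL gL x fx gx.
have [h hL fhf] := linear_regular fL; have [k kL gkg] := linear_regular gL.
have hfL := linear_comp fL hL; have kgL := linear_comp gL kL.
have pfL := linear_sub (@linear_id V) hfL.
have pgL := linear_sub (@linear_id W) kgL.
have pfx : tmap (id \- (h \o f)) id x = x.
  rewrite (tmap_subl (@linear_id V) hfL (@linear_id W)) tmap_idP //.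
  rewrite -(tmap_comp fL hL (@linear_id W) (@linear_id W)) fx.
  by rewrite (lin0 (tmap_linear hL (@linear_id W))) subr0.
have pgx : tmap id (id \- (k \o g)) x = x.
  rewrite (tmap_subr (@linear_id V) (@linear_id W) kgL) tmap_idP //.
  rewrite -(tmap_comp (@linear_id V) (@linear_id V) gL kL) gx.
  by rewrite (lin0 (tmap_linear (@linear_id V) kL)) subr0.
exists [seq (p.1 - h (f p.1), p.2 - k (g p.2)) | p <- repr x].
  by move=> _ /mapP[p _ ->] /=; rewrite !linB // fhf gkg !subrr.
rewrite big_map -(tmap_sum_pure pfL pgL) -tens_reprE -[LHS]pfx -[in LHS]pgx.
by rewrite (tmap_comp (@linear_id V) pfL pgL (@linear_id W)).
Qed.

(** A generalized inverse of an injective map is a left inverse. *)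
Lemma tmap_inj0 (V V' W W' : lmodType F) (f : V -> V') (g : W -> W') :
  linear f -> linear g -> injective f -> injective g ->
  forall x, tmap f g x = 0 -> x = 0.
Proof.
move=> fL gL fI gI x fgx.
have [h hL fhf] := linear_regular fL; have [k kL gkg] := linear_regular gL.
have := tmap_comp fL hL gL kL x; rewrite fgx (lin0 (tmap_linear hL kL)).
by rewrite tmap_idP // => v /=; [apply: fI | apply: gI].
Qed.

Definition fev (I : finType) (V : lmodType F) (i : I) (f : {ffun I -> V}) : V :=
  f i.

Definition fdelta (I : finType) (V : lmodType F) (i : I) (v : V) :
  {ffun I -> V} := [ffun k => if k == i then v else 0].

Lemma fev_linear (I : finType) (V : lmodType F) (i : I) : linear (@fev I V i).
Proof. by move=> a u v; rewrite /fev !ffunE. Qed.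

Lemma fdelta_linear (I : finType) (V : lmodType F) (i : I) :
  linear (@fdelta I V i).
Proof.
move=> a u v; apply/ffunP => k; rewrite !ffunE.
by case: eqP => // _; rewrite scaler0 addr0.
Qed.

Lemma ffun_sum_delta (I : finType) (V : lmodType F) (f : {ffun I -> V}) :
  f = \sum_i fdelta i (fev i f).
Proof.
apply/ffunP => k; rewrite sum_ffunE (bigD1 k) //= ffunE eqxx big1 ?addr0 //.
by move=> i ik; rewrite ffunE eq_sym (negbTE ik).
Qed.

Lemma linear_sum_fun I (r : seq I) (V W : lmodType F) (f : I -> V -> W) :
  (forall i, linear (f i)) -> linear (fun x => \sum_(i <- r) f i x).
Proof.
move=> fL a x y; rewrite scaler_sumr -big_split.
by apply: eq_bigr => i _; rewrite fL.
Qed.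

(** The tensor product of V^I and W^J is the sum of I * J copies of the tensor
    product of V and W; so its elements are determined by their coordinates
    [tmap (fev i) (fev j)], which can be chosen freely. *)
Lemma tens_ffunE (I J : finType) (V W : lmodType F)
    (x : tens {ffun I -> V} {ffun J -> W}) :
  x = \sum_i \sum_j tmap (fdelta i) (fdelta j) (tmap (fev i) (fev j) x).
Proof.
have eL := fev_linear; have dL := fdelta_linear.
move: x; apply: (@linear_eq_tens _ _ _ id) => [//||f g].
  do 2 (apply: linear_sum_fun => ?); apply: (@linear_comp _ _ _ (tmap _ _)).
    by apply: tmap_linear; apply: eL.
  by apply: tmap_linear; apply: dL.
rewrite [in LHS](ffun_sum_delta f) [in LHS](ffun_sum_delta g).
rewrite (bilin_suml (bilin_tpure _ _)); apply: eq_bigr => i _.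
rewrite (bilin_sumr (bilin_tpure _ _)); apply: eq_bigr => j _.
by rewrite (tmap_pure (eL _ _ i) (eL _ _ j)) (tmap_pure (dL _ _ i) (dL _ _ j)).
Qed.

Lemma tens_ffun_eq0 (I J : finType) (V W : lmodType F)
    (x : tens {ffun I -> V} {ffun J -> W}) :
  (forall i j, tmap (fev i) (fev j) x = 0) -> x = 0.
Proof.
move=> x0; rewrite (tens_ffunE x) big1 // => i _; rewrite big1 // => j _.
by rewrite x0 (lin0 (tmap_linear (fdelta_linear _) (fdelta_linear _))).
Qed.

Lemma tens_ffun_exists (I J : finType) (V W : lmodType F)
    (x : I -> J -> tens V W) :
  exists X : tens {ffun I -> V} {ffun J -> W},
    forall i j, tmap (fev i) (fev j) X = x i j.
Proof.
have eL i := @fev_linear I V i; have eL' j := @fev_linear J W j.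
have dL i := @fdelta_linear I V i; have dL' j := @fdelta_linear J W j.
have tE (i i' : I) (j j' : J) (y : tens V W) :
    tmap (fev i) (fev j) (tmap (fdelta i') (fdelta j') y) =
    if (i == i') && (j == j') then y else 0.
  move: y; apply: linear_eq_tens => [||v w].
  - exact: (linear_comp (tmap_linear (dL i') (dL' j'))
                        (tmap_linear (eL i) (eL' j))).
  - by move=> a y z; case: ifP => // _; rewrite scaler0 addr0.
  rewrite (tmap_pure (dL _) (dL' _)) (tmap_pure (eL _) (eL' _)) /fev !ffunE.
  by case: (i == i'); case: (j == j'); rewrite ?tpure0l ?tpure0r.
exists (\sum_i \sum_j tmap (fdelta i) (fdelta j) (x i j)) => i j.
have tL := tmap_linear (eL i) (eL' j).
rewrite (lin_sum tL) (bigD1 i) //= [X in _ + X]big1 ?addr0 => [|i' ii'].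
  rewrite (lin_sum tL) (bigD1 j) //= [X in _ + X]big1 ?addr0 => [|j' jj'].
    by rewrite tE !eqxx.
  by rewrite tE eqxx eq_sym (negbTE jj').
by rewrite (lin_sum tL) big1 // => j' _; rewrite tE eq_sym (negbTE ii').
Qed.

End LinearAlgebra.

(** * Spans and finite presentations *)

Section Span.
Variables (R : pzRingType) (M : lmodType R).
Implicit Types S : set M.

Definition lspan S : set M := [set x | exists2 s : seq (R * M),
  (forall p, p \in s -> S p.2) & x = \sum_(p <- s) p.1 *: p.2].

Lemma lspan0 S : lspan S 0.
Proof. by exists [::]; rewrite ?big_nil. Qed.

Lemma lspanD S x y : lspan S x -> lspan S y -> lspan S (x + y).
Proof.
move=> [s sS ->] [t tS ->]; exists (s ++ t); last by rewrite big_cat.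
by move=> p; rewrite mem_cat => /orP[/sS|/tS].
Qed.

Lemma lspanZ S a x : lspan S x -> lspan S (a *: x).
Proof.
move=> [s sS ->]; exists [seq (a * p.1, p.2) | p <- s].
  by move=> _ /mapP[p /sS ? ->].
by rewrite big_map scaler_sumr; apply: eq_bigr => p _; rewrite scalerA.
Qed.

Lemma lspan_gen S x : S x -> lspan S x.
Proof.
move=> Sx; exists [:: (1, x)]; last by rewrite big_seq1 scale1r.
by move=> p; rewrite inE => /eqP ->.
Qed.

Lemma lspan_sum S I (r : seq I) (P : pred I) (x : I -> M) :
  (forall i, P i -> lspan S (x i)) -> lspan S (\sum_(i <- r | P i) x i).
Proof. by move=> Sx; elim/big_ind: _ => //; [apply: lspan0|apply: lspanD]. Qed.

Lemma lspan_fin S n (x : 'I_n -> M) : (forall i, lspan S (x i)) ->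
  exists2 s : seq M, (forall y, y \in s -> S y) &
    forall i, lspan [set y | y \in s] (x i).
Proof.
move=> H.
have Hex i : exists t : seq (R * M),
    (forall p, p \in t -> S p.2) /\ x i = \sum_(p <- t) p.1 *: p.2.
  by case: (H i) => s ? ?; exists s.
have [t tP] := choice Hex.
exists (flatten [seq [seq p.2 | p <- t i] | i : 'I_n]).
  by move=> y /flatten_mapP[i _ /mapP[p pt ->]]; apply: (tP i).1.
move=> i; exists (t i); last exact: (tP i).2.
by move=> p pt; apply/flatten_mapP; exists i; rewrite ?mem_enum // map_f.
Qed.

Lemma lspan_nth (s : seq M) x : lspan [set y | y \in s] x ->
  exists c : 'rV[R]_(size s), x = \sum_i c 0 i *: s`_i.
Proof.
move=> [t tS ->].
have : forall p, p \in t -> exists i : 'I_(size s), p.2 = s`_i.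
  move=> p /tS /= ps; have Hi := ps; rewrite -index_mem in Hi.
  by exists (Ordinal Hi); rewrite nth_index.
elim: t {tS} => [|p t IH] tS.
  by exists 0; rewrite big_nil big1 // => i _; rewrite mxE scale0r.
have [|c E] := IH; first by move=> q qt; apply: tS; rewrite inE qt orbT.
have [|i Ei] := tS p; first by rewrite inE eqxx.
exists (c + p.1 *: delta_mx 0 i); rewrite big_cons E addrC.
pose d : 'rV[R]_(size s) := delta_mx 0 i.
transitivity (\sum_j (c 0 j *: s`_j + (p.1 * d 0 j) *: s`_j)).
  rewrite big_split /=; congr (_ + _); rewrite (bigD1 i) //= big1 => [|j ji].
    by rewrite mxE !eqxx mulr1 addr0 Ei.
  by rewrite mxE (negbTE ji) mulr0 scale0r.
by apply: eq_bigr => j _; rewrite !mxE scalerDl.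
Qed.

End Span.

Section RowCombination.
Variables (R : pzRingType) (M : lmodType R).

Definition rowcomb n (u : 'I_n -> M) (a : 'rV[R]_n) : M := \sum_i a 0 i *: u i.

Lemma rowcomb_linear n (u : 'I_n -> M) : linear (rowcomb u).
Proof.
move=> c a b; rewrite /rowcomb scaler_sumr -big_split; apply: eq_bigr => i _.
by rewrite !mxE scalerDl scalerA.
Qed.

Lemma rowcombD n (u : 'I_n -> M) a b :
  rowcomb u (a + b) = rowcomb u a + rowcomb u b.
Proof.
by rewrite /rowcomb -big_split; apply: eq_bigr => i _; rewrite !mxE scalerDl.
Qed.

Lemma rowcombB n (u : 'I_n -> M) a b :
  rowcomb u (a - b) = rowcomb u a - rowcomb u b.
Proof.
by rewrite /rowcomb -sumrB; apply: eq_bigr => i _; rewrite !mxE scalerBl.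
Qed.

Lemma rowcomb_mul m n (u : 'I_n -> M) (c : 'rV[R]_m) (b : 'M[R]_(m, n)) :
  rowcomb u (c *m b) = rowcomb (fun k => rowcomb u (row k b)) c.
Proof.
rewrite /rowcomb; under eq_bigr do rewrite mxE scaler_suml.
rewrite exchange_big; apply: eq_bigr => k _; rewrite scaler_sumr.
by apply: eq_bigr => i _; rewrite mxE scalerA.
Qed.

Lemma rowcomb_delta n (u : 'I_n -> M) i : rowcomb u (delta_mx 0 i) = u i.
Proof.
rewrite /rowcomb (bigD1 i) //= mxE !eqxx scale1r big1 ?addr0 // => j ji.
by rewrite mxE (negbTE ji) scale0r.
Qed.

Lemma rowcombE n (p : {linear 'rV[R]_n -> M}) a :
  p a = rowcomb (fun i => p (delta_mx 0 i)) a.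
Proof.
rewrite {1}[a]row_sum_delta linear_sum.
by apply: eq_bigr => i _; rewrite linearZ.
Qed.

Definition presentation m n (u : 'I_n -> M) (b : 'M[R]_(m, n)) : Prop :=
  (forall x, exists a, x = rowcomb u a) /\
  (forall a, rowcomb u a = 0 <-> exists c, a = c *m b).

Lemma presentation_rel m n (u : 'I_n -> M) (b : 'M[R]_(m, n)) k :
  presentation u b -> rowcomb u (row k b) = 0.
Proof. by move=> ub; apply/ub.2; exists (delta_mx 0 k); rewrite rowE. Qed.

Lemma rowcomb_lift m n (u : 'I_m -> M) (v : 'I_n -> M) :
  (forall x, exists a, x = rowcomb v a) ->
  exists s : 'M[R]_(m, n), forall a, rowcomb u a = rowcomb v (a *m s).
Proof.
move=> vgen; have [s sE] := choice (fun i => vgen (u i)).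
exists (\matrix_i s i) => a; rewrite rowcomb_mul.
by apply: eq_bigr => i _; rewrite rowK -sE.
Qed.

(** If s and t express the generators u by v and v by u, then the relations
    between the v_j are generated by the translated relations b s together with
    1 - t s, which says that rewriting v in terms of u and back changes
    nothing. *)
Lemma presentation_change m n n' (u : 'I_n -> M) (b : 'M[R]_(m, n))
    (v : 'I_n' -> M) :
  presentation u b -> (forall x, exists a, x = rowcomb v a) ->
  exists b' : 'M[R]_(n' + m, n'), presentation v b'.
Proof.
move=> [ugen urel] vgen.
have [s uv] := rowcomb_lift u vgen; have [t vu] := rowcomb_lift v ugen.
exists (col_mx (1%:M - t *m s) (b *m s)); split=> // a; split.
  rewrite vu => /urel[c E]; exists (row_mx a c).
  by rewrite mul_row_col mulmxBr mulmx1 !mulmxA -E subrK.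
move=> [c ->]; rewrite -[c]hsubmxK mul_row_col mulmxBr mulmx1 !mulmxA.
rewrite rowcombD rowcombB -!uv -vu subrr add0r.
by apply/urel; exists (rsubmx c).
Qed.

Lemma finitely_presentedP : finitely_presented M ->
  exists m n (u : 'I_n -> M) (b : 'M[R]_(m, n)), presentation u b.
Proof.
move=> [m [n [f [p [pS pK]]]]].
exists m, n, (fun i => p (delta_mx 0 i)), (\matrix_k f (delta_mx 0 k)).
have fE c : f c = c *m \matrix_k f (delta_mx 0 k).
  rewrite mulmx_sum_row {1}[c]row_sum_delta linear_sum.
  by apply: eq_bigr => k _; rewrite linearZ rowK.
split=> [x|a]; rewrite -?rowcombE.
  have : [set: M] x by [].
  rewrite -pS => -[a _ <-].
  by exists a; rewrite rowcombE.
have -> : (p a = 0) = range f a by rewrite -pK.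
by split=> [[c _ <-]|[c ->]]; exists c; rewrite ?fE.
Qed.

End RowCombination.

(** * Presentations in degree 1 of modules over strongly graded algebras *)

Section GradedPresentation.
Variables (F : fieldType) (G : groupType) (A : grAlg F G).

Definition aproj (g : G) : A -> A := proj (acomp_sub A) (acomp_dsum A) g.

Lemma aprojP g a : acomp A g (aproj g a).
Proof.
by have [s [_ + _ _]] := projP (acomp_sub A) (acomp_dsum A) a; apply.
Qed.

(** Since 1 is in A_g A_(g^-1), an element x of degree g is a sum of terms
    a (a' x) with a in A_g and a' in A_(g^-1), and each a' x has degree 1.
    M is W itself in one application and a module of relations in another,
    with C the homogeneous elements of M. *)
Lemma strongly_graded_span (M : lmodType A) (C : G -> set M) :
  strongly_graded A ->
  (forall g h a x, acomp A g a -> C h x -> C (g * h)%g (a *: x)) ->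
  sum_of C `<=` lspan (C 1%g).
Proof.
move=> Astrong CM _ [s [c [_ Cc ->]]]; apply: lspan_sum => g _.
have : acomp A (g * g^-1)%g 1 by rewrite mulgV; apply: acomp1.
rewrite -Astrong => -[t tP E]; rewrite -[c g]scale1r E scaler_suml big_seq.
apply: lspan_sum => p /tP[p1 p2]; rewrite -scalerA; apply/lspanZ/lspan_gen.
by rewrite -(mulVg g); apply: CM.
Qed.

Variable W : grMod A.

Definition mproj (g : G) : restr W -> restr W :=
  proj (@mcomp_restr_sub F G A W) (mcomp_dsum W) g.

Lemma mprojP g w : mcomp W g (mproj g w).
Proof.
have [s [_ + _ _]] := projP (@mcomp_restr_sub F G A W) (mcomp_dsum W) w.
exact.
Qed.

Lemma mproj_linear g : linear (mproj g).
Proof. by move=> a u v; rewrite /mproj projD projZ. Qed.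

Lemma mproj_hom g w : mcomp W g w -> mproj g w = w.
Proof. by move=> Ww; rewrite /mproj (proj_hom _ _ _ Ww) eqxx. Qed.

Lemma mproj_scale g (a : A) (u : W) :
  mcomp W 1%g u -> mproj g (a *: u) = aproj g a *: u.
Proof.
move=> Wu; have aL : linear (aproj g).
  by move=> c x y; rewrite /aproj projD projZ.
elim/acomp_ind: a => [|a b IHa IHb|h a Aa].
- by rewrite scale0r (lin0 aL) scale0r; exact: (lin0 (mproj_linear g)).
- by rewrite !scalerDl (linD (mproj_linear g)) (linD aL) scalerDl IHa IHb.
have Wau : mcomp W h (a *: u) by rewrite -(mulg1 h); apply: mcompM.
rewrite /mproj /aproj (proj_hom _ _ _ Wau) (proj_hom _ _ _ Aa).
by case: eqP => // _; rewrite scale0r.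
Qed.

Lemma mproj_rowcomb n (u : 'I_n -> W) g (a : 'rV[A]_n) :
  (forall i, mcomp W 1%g (u i)) ->
  mproj g (rowcomb u a) = rowcomb u (map_mx (aproj g) a).
Proof.
move=> Wu; rewrite (lin_sum (mproj_linear g)); apply: eq_bigr => i _.
by rewrite mproj_scale // mxE.
Qed.

Lemma row_dec n (a : 'rV[A]_n) :
  exists2 s : seq G, uniq s & a = \sum_(g <- s) map_mx (aproj g) a.
Proof.
have [s sP] := choice (fun i => projP (acomp_sub A) (acomp_dsum A) (a 0 i)).
exists (undup (flatten [seq s i | i : 'I_n])); first exact: undup_uniq.
apply/rowP => i; rewrite summxE; have [us _ s0 {1}->] := sP i.
under [RHS]eq_bigr do rewrite mxE.
apply: sum_widen => //; first exact: undup_uniq.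
move=> g gs; rewrite mem_undup; apply/flatten_mapP.
by exists i; rewrite ?mem_enum.
Qed.

Hypothesis Astrong : strongly_graded A.

Lemma graded_generators n (w : 'I_n -> W) :
  (forall x, exists a, x = rowcomb w a) ->
  exists m (u : 'I_m -> W), (forall i, mcomp W 1%g (u i)) /\
    forall x, exists a, x = rowcomb u a.
Proof.
move=> wgen.
have Wspan x : lspan (mcomp W 1%g) x.
  apply: strongly_graded_span => //; first exact: mcompM.
  by case: (mcomp_dsum W) => ->.
have [s sW ws] := lspan_fin (fun i => Wspan (w i)).
exists (size s), (fun i => s`_i); split=> [i|x]; first exact/sW/mem_nth.
apply: lspan_nth; have [a ->] := wgen x.
by apply: lspan_sum => i _; apply: lspanZ.
Qed.

(** After passing to generators of degree 1, the relations form a submodule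
    that contains the homogeneous components of its elements, so that
    [strongly_graded_span] applies to it; the finitely many given relations then
    involve only finitely many relations of degree 1. *)
Lemma graded_presentation : finitely_presented W ->
  exists m n (u : 'I_n -> W) (b : 'M[A]_(m, n)),
  [/\ presentation u b, forall i, mcomp W 1%g (u i) &
      forall k i, acomp A 1%g (b k i)].
Proof.
move=> /finitely_presentedP[m0 [n0 [w [r0 wr]]]].
have [n [u [Wu ugen]]] := graded_generators wr.1.
have [r [_ urel]] := presentation_change wr ugen.
pose C h : set 'rV[A]_n :=
  [set a | rowcomb u a = 0 /\ forall i, acomp A h (a 0 i)].
have CM g h a x : acomp A g a -> C h x -> C (g * h)%g (a *: x).
  move=> Aa [x0 Ax]; split=> [|i]; last by rewrite mxE; apply: acompM.
  have := rowcomb_linear u a x 0; rewrite !addr0 x0 scaler0 add0r => ->.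
  by apply/urel; exists 0; rewrite mul0mx.
have Cspan a : rowcomb u a = 0 -> lspan (C 1%g) a.
  move=> a0; apply: strongly_graded_span => //.
  have [s us E] := row_dec a.
  exists s, (fun g => map_mx (aproj g) a); split=> // g; split=> [|i].
    rewrite -mproj_rowcomb // a0; exact: (lin0 (mproj_linear g)).
  by rewrite mxE; apply: aprojP.
have [|s sC rs] := @lspan_fin _ _ (C 1%g) _ (fun k => row k r).
  by move=> k; apply/Cspan/urel; exists (delta_mx 0 k); rewrite -rowE.
exists (size s), n, u, (\matrix_k s`_k); split=> //; last first.
  by move=> k i; rewrite mxE; have [_ ] := sC _ (mem_nth 0 (ltn_ord k)); apply.
split=> // a; split.
  move=> /urel[c ->].
  have [|d ->] := @lspan_nth _ _ s (c *m r).
    by rewrite mulmx_sum_row; apply: lspan_sum => k _; apply: lspanZ.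
  by exists d; rewrite mulmx_sum_row; apply: eq_bigr => k _; rewrite rowK.
move=> [c ->]; rewrite rowcomb_mul /rowcomb big1 // => k _; rewrite rowK.
have [] := sC _ (mem_nth 0 (ltn_ord k)).
by rewrite /rowcomb => ->; rewrite scaler0.
Qed.

End GradedPresentation.

(** The universal property of generators and relations. *)
Lemma presentation_hom (R : pzRingType) (M N : lmodType R) m n
    (u : 'I_n -> M) (b : 'M[R]_(m, n)) (v : 'I_n -> N) :
  presentation u b -> (forall k, rowcomb v (row k b) = 0) ->
  exists phi : {linear M -> N}, forall a, phi (rowcomb u a) = rowcomb v a.
Proof.
move=> [ugen urel] vb; have [c uc] := choice ugen.
have v0 a : rowcomb u a = 0 -> rowcomb v a = 0.
  move=> /urel[d ->]; rewrite rowcomb_mul /rowcomb big1 // => k _.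
  by have := vb k; rewrite /rowcomb => ->; rewrite scaler0.
have fE a : rowcomb v (c (rowcomb u a)) = rowcomb v a.
  apply/eqP; rewrite -subr_eq0 -rowcombB; apply/eqP/v0.
  by rewrite rowcombB -uc subrr.
have fL : linear (fun x => rowcomb v (c x)).
  by move=> k x y; rewrite -rowcomb_linear {1}[x]uc {1}[y]uc -rowcomb_linear fE.
exists (HB.pack_for {linear M -> N} (fun x => rowcomb v (c x))
    (GRing.isLinear.Build R M N _ _ fL)).
exact: fE.
Qed.

Lemma rEnd_eq_lspan (F : fieldType) (A : pzAlgType F) (W : lmodType A)
    (S : set W) (phi psi : rEnd W) :
  (forall w, S w -> phi w = psi w) -> forall w, lspan S w -> phi w = psi w.
Proof.
move=> E _ [s sS ->]; rewrite /rEnd_fun !linear_sum; apply: eq_big_seq => p ps.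
by rewrite !linearZ; congr (_ *: _); apply/E/sS.
Qed.

Section HomogeneousGenerators.
Variables (F : fieldType) (G : groupType) (A : grAlg F G) (W : grMod A).
Variables (m n : nat) (u : 'I_n -> W) (b : 'M[A]_(m, n)).
Hypotheses (ub : presentation u b) (Wu : forall i, mcomp W 1%g (u i)).

Lemma homogeneous_rowcomb h w : mcomp W h w ->
  exists2 a : 'rV_n, (forall i, acomp A h (a 0 i)) & w = rowcomb u a.
Proof.
move=> Ww; have [a E] := ub.1 w; exists (map_mx (aproj h) a).
  by move=> i; rewrite mxE; apply: aprojP.
by rewrite -mproj_rowcomb // -E mproj_hom.
Qed.

(** Since the generators have degree 1, an element of W_h is a combination of
    them with coefficients in A_h; hence the induced endomorphism has degree g
    as soon as its values at the generators have. *)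
Lemma rEnd_extend g (v : 'I_n -> W) : (forall i, mcomp W g (v i)) ->
  (forall k, rowcomb v (row k b) = 0) ->
  exists2 phi : rEnd W, rEnd_comp g phi & forall i, phi (u i) = v i.
Proof.
move=> Wv vb; have [phi phiE] := presentation_hom ub vb.
exists phi => [h w /homogeneous_rowcomb[a Aa ->]|i].
  rewrite /rEnd_fun phiE /rowcomb; apply: (sg_sum (mcomp_sub W)) => i _.
  exact: mcompM.
by rewrite -{1}[u i]rowcomb_delta /rEnd_fun phiE rowcomb_delta.
Qed.

Lemma rEnd_eq (phi psi : rEnd W) :
  (forall i, phi (u i) = psi (u i)) -> phi = psi.
Proof.
move=> E; apply: rEndP => w; have [a ->] := ub.1 w.
rewrite /rEnd_fun !linear_sum; apply: eq_bigr => i _; rewrite !linearZ.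
by congr (_ *: _); apply: E.
Qed.

End HomogeneousGenerators.

(** * The comparison morphism *)

Section Comparison.
Variables (F : fieldType) (G : groupType) (A A' : grAlg F G).
Variables (W : grMod A) (W' : grMod A').
Local Notation E := (gr_rEnd W).
Local Notation E' := (gr_rEnd W').
Local Notation T := (tens (restr W) (restr W')).

Definition endo_eval (B : grAlg F G) (M : grMod B) (phi : gr_rEnd M)
    (w : restr M) : restr M := (val phi : rEnd M) w.

Lemma bilin_endo_eval (B : grAlg F G) (M : grMod B) : bilin (@endo_eval B M).
Proof.
split=> //.
- by move=> phi v w; apply: rEndD.
- by move=> a phi w; apply: rEndZ.
Qed.

Definition tens_endo : tens E E' -> T -> T :=
  tmap2 (@endo_eval A W) (@endo_eval A' W').

Lemma bilin_tens_endo : bilin tens_endo.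
Proof. by apply: bilin_tmap2; apply: bilin_endo_eval. Qed.

Lemma tens_endo_pure phi psi w w' : tens_endo (tpure phi psi) (tpure w w') =
  tpure (endo_eval phi w) (endo_eval psi w').
Proof. by apply: tmap2_pure; apply: bilin_endo_eval. Qed.

Lemma tens_endo_linear x : linear (tens_endo x).
Proof.
move=> a y z.
by rewrite (bilinDr bilin_tens_endo) (bilinZr bilin_tens_endo).
Qed.

Lemma tens_endo_linearl y : linear (tens_endo^~ y).
Proof.
move=> a x z.
by rewrite (bilinDl bilin_tens_endo) (bilinZl bilin_tens_endo).
Qed.

Lemma tens_endo1 y : tens_endo 1 y = y.
Proof.
move: y; apply: linear_eq_tens => [||w w']; [exact: tens_endo_linear|by []|].
exact: tens_endo_pure.
Qed.

Lemma tens_endoM x x' y : tens_endo (x * x') y = tens_endo x' (tens_endo x y).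
Proof.
move: y; apply: linear_eq_tens => [||w w']; first exact: tens_endo_linear.
  by apply: linear_comp; apply: tens_endo_linear.
move: x'; apply: linear_eq_tens => [a y z||phi' psi'].
- rewrite mulrDr -tens_scaleAr; exact: tens_endo_linearl.
- exact: tens_endo_linearl.
move: x; apply: linear_eq_tens => [a y z|a y z|phi psi].
- rewrite mulrDl -tens_scaleAl; exact: tens_endo_linearl.
- by rewrite tens_endo_linearl tens_endo_linear.
by rewrite [_ * _]tens_mul_pure !tens_endo_pure.
Qed.

Lemma tens_act_linear x : linear (@tens_act _ _ _ _ W W' x).
Proof.
move=> a y z.
by rewrite (bilinDr (bilin_tens_act _ _)) (bilinZr (bilin_tens_act _ _)).
Qed.

Lemma tens_act_linearl y : linear ((@tens_act _ _ _ _ W W')^~ y).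
Proof.
move=> a x z.
by rewrite (bilinDl (bilin_tens_act _ _)) (bilinZl (bilin_tens_act _ _)).
Qed.

Lemma tens_endo_act x (a : tens A A') y :
  tens_endo x (tens_act a y) = tens_act a (tens_endo x y).
Proof.
move: y; apply: linear_eq_tens => [||w w'].
- by apply: linear_comp; [apply: tens_act_linear | apply: tens_endo_linear].
- by apply: linear_comp; [apply: tens_endo_linear | apply: tens_act_linear].
move: a; apply: linear_eq_tens => [c y z|c y z|a a'].
- by rewrite tens_act_linearl tens_endo_linear.
- exact: tens_act_linearl.
move: x; apply: linear_eq_tens => [c y z|c y z|phi psi].
- exact: tens_endo_linearl.
- by rewrite tens_endo_linearl tens_act_linear.
rewrite tens_act_pure !tens_endo_pure tens_act_pure; congr (tpure _ _).
  exact: rEndZ.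
exact: rEndZ.
Qed.

Lemma tens_endo_comp g h x y :
  tens_comp (acomp E) (acomp E') g x -> tens_mcomp h y ->
  tens_mcomp (h * g)%g (tens_endo x y).
Proof.
move=> [s sP ->] [t tP ->].
exists [seq (endo_eval p.1 q.1, endo_eval p.2 q.2) | p <- s, q <- t].
  move=> _ /allpairsP[[p q] [ps qt ->]] /=.
  have [Ep Ep'] := sP _ ps; have [Wq Wq'] := tP _ qt.
  by split; [apply: Ep | apply: Ep'].
rewrite (bilin_suml bilin_tens_endo) big_allpairs_dep; apply: eq_bigr => p _.
rewrite (bilin_sumr bilin_tens_endo); apply: eq_bigr => q _.
exact: tens_endo_pure.
Qed.

Lemma tens_endo_pred (x : gr_tens E E') (w : tensM W W') :
  tens_endo (val x) (val w) \in @tensM_pred _ _ _ _ W W'.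
Proof.
have subg := @tens_mcomp_subg _ _ _ _ W W'.
have /asboolP Sw := valP w; have /asboolP Sx := valP x; apply/asboolP.
elim/(sum_of_ind (C := fcomp (tens_family E E'))): Sx =>
    [|x1 x2 IH IH'|g x1 Sx].
- by rewrite (lin0 (tens_endo_linearl _)); case: (sum_of_subgroup subg).
- by rewrite (linD (tens_endo_linearl _)); apply: (sum_ofD subg).
elim/(sum_of_ind (C := @tens_mcomp _ _ _ _ W W')): Sw =>
    [|y1 y2 IH IH'|h y1 Sy].
- by rewrite (lin0 (tens_endo_linear _)); case: (sum_of_subgroup subg).
- by rewrite (linD (tens_endo_linear _)); apply: (sum_ofD subg).
exact: (sum_of_hom subg (tens_endo_comp Sx Sy)).
Qed.

Definition comparison_fun (x : gr_tens E E') (w : gr_tensM W W') :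
    gr_tensM W W' :=
  exist _ (tens_endo (val x) (val w)) (tens_endo_pred x w).

Lemma comparison_fun_linear x : linear (comparison_fun x).
Proof.
move=> a u v; apply: val_inj => /=.
by rewrite (linD (tens_endo_linear _)) tens_endo_act.
Qed.

Definition comparison_rEnd (x : gr_tens E E') : rEnd (gr_tensM W W') :=
  HB.pack_for {linear gr_tensM W W' -> gr_tensM W W'} (comparison_fun x)
    (GRing.isLinear.Build _ _ _ _ _ (comparison_fun_linear x)).

Lemma comparison_rEndE x w :
  val (comparison_rEnd x w) = tens_endo (val x) (val w).
Proof. by []. Qed.

Lemma comparison_comp g x : acomp (gr_tens E E') g x ->
  rEnd_comp g (comparison_rEnd x).
Proof. by move=> Ex h w; apply: tens_endo_comp. Qed.

Lemma comparison_rEndD x y :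
  comparison_rEnd (x + y) = comparison_rEnd x + comparison_rEnd y.
Proof.
by apply: rEndP => w; apply: val_inj; apply: (linD (tens_endo_linearl _)).
Qed.

Lemma comparison_pred x :
  comparison_rEnd x \in gsub_pred (rEnd_family (gr_tensM W W')).
Proof.
have subg g := subspace_subgroup (@rEnd_comp_sub _ _ _ (gr_tensM W W') g).
apply/asboolP; elim/acomp_ind: x => [|x y IHx IHy|g x Ex].
- have -> : comparison_rEnd 0 = 0.
    by apply: rEndP => w; apply: val_inj; apply: (lin0 (tens_endo_linearl _)).
  by case: (sum_of_subgroup subg).
- by rewrite comparison_rEndD; apply: (sum_ofD subg).
exact: (sum_of_hom subg (comparison_comp Ex)).
Qed.

Definition comparison (x : gr_tens E E') : gr_rEnd (gr_tensM W W') :=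
  exist _ (comparison_rEnd x) (comparison_pred x).

Lemma comparison_eq x (theta : gr_rEnd (gr_tensM W W')) :
  (forall w : gr_tensM W W',
     tens_endo (val x) (val w) = val ((val theta : rEnd _) w)) ->
  comparison x = theta.
Proof. by move=> H; apply/val_inj/rEndP => w; apply: val_inj; apply: H. Qed.

Lemma scale_tensM (a : F) (w : gr_tensM W W') :
  val ((a *: (1 : gr_tens A A')) *: w) = a *: val w.
Proof.
change (tens_act (a *: (1 : tens A A')) (val w) = a *: val w).
by rewrite (bilinZl (bilin_tens_act _ _)) tens_act1.
Qed.

Lemma comparison_linear : linear comparison.
Proof.
move=> a x y; apply: comparison_eq => w.
transitivity (a *: tens_endo (val x) (val w) + tens_endo (val y) (val w)).
  exact: tens_endo_linearl.
by rewrite -[a *: _](scale_tensM a (comparison_rEnd x w)).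
Qed.

Lemma comparison1 : comparison 1 = 1.
Proof. by apply: comparison_eq => w; apply: tens_endo1. Qed.

Lemma comparisonM x y : comparison (x * y) = comparison x * comparison y.
Proof. by apply: comparison_eq => w; apply: tens_endoM. Qed.

End Comparison.

(** * Endomorphisms of degree g as a kernel *)

Section RelationMap.
Variables (F : fieldType) (G : groupType) (A : grAlg F G) (W : grMod A).
Variables (m n : nat) (u : 'I_n -> W) (b : 'M[A]_(m, n)).
Variable g : G.

(** Its kernel consists of the vectors in (W_g)^n that satisfy the relations b;
    the condition of lying in W_g is expressed by the components [inr i]. *)
Definition relmap (f : {ffun 'I_n -> restr W}) :
    {ffun 'I_m + 'I_n -> restr W} :=
  [ffun c => match c with
   | inl k => rowcomb (f : 'I_n -> W) (row k b)
   | inr i => f i - mproj g (f i)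
   end].

Lemma restr_scale_linear (a : A) :
  linear (fun w : restr W => a *: (w : W) : restr W).
Proof.
have B := bilin_act W.
by move=> c v w; rewrite (bilinDr B) (bilinZr B).
Qed.

Lemma relmap_linear : linear relmap.
Proof.
move=> c f f'; apply/ffunP => -[k|i]; rewrite !ffunE.
  rewrite /rowcomb scaler_sumr -big_split; apply: eq_bigr => i _ /=.
  by rewrite !ffunE restr_scale_linear.
by rewrite mproj_linear opprD addrACA -scalerBr.
Qed.

Definition evalgens (phi : gr_rEnd W) : {ffun 'I_n -> restr W} :=
  [ffun i => endo_eval phi (u i)].

Lemma evalgens_linear : linear evalgens.
Proof.
have B := bilin_endo_eval W.
by move=> c f f'; apply/ffunP => i; rewrite !ffunE (bilinDl B) (bilinZl B).
Qed.

Hypotheses (ub : presentation u b) (Wu : forall i, mcomp W 1%g (u i)).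

Lemma evalgens_inj : injective evalgens.
Proof.
move=> phi psi /ffunP E; apply/val_inj/(rEnd_eq ub) => i.
by have := E i; rewrite !ffunE.
Qed.

Lemma relmap_endo f : relmap f = 0 ->
  exists2 phi : gr_rEnd W, acomp (gr_rEnd W) g phi & evalgens phi = f.
Proof.
move=> /ffunP f0; have Wf i : mcomp W g (f i).
  have /eqP := f0 (inr i); rewrite !ffunE subr_eq0 => /eqP ->.
  exact: mprojP.
have [|phi phig phiE] := rEnd_extend ub Wu Wf.
  by move=> k; have := f0 (inl k); rewrite !ffunE.
have phiP : phi \in gsub_pred (rEnd_family W).
  apply/asboolP; apply: sum_of_hom phig => h.
  exact: (subspace_subgroup (@rEnd_comp_sub _ _ _ W h)).
exists (exist _ phi phiP) => //.
by apply/ffunP => i; rewrite ffunE; apply: phiE.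
Qed.

End RelationMap.

(** * Tensors killed by the relation maps *)

Section RelationKernel.
Variables (F : fieldType) (G : groupType) (A A' : grAlg F G).
Variables (W : grMod A) (W' : grMod A').
Variables (m n m' n' : nat) (b : 'M[A]_(m, n)) (b' : 'M[A']_(m', n')) (g : G).
Variable X : tens {ffun 'I_n -> restr W} {ffun 'I_n' -> restr W'}.
Local Notation X_ i j := (tmap (fev i) (fev j) X).

Local Notation iL i := (@fev_linear F 'I_n (restr W) i).
Local Notation jL j := (@fev_linear F 'I_n' (restr W') j).
Local Notation idL := (@linear_id F _).

Hypothesis Xg : forall i j, tens_mcomp g (X_ i j).

(** The coordinates [inl k] of the image vanish by the relations, the
    coordinates [inr i] because the coordinates of X have degree g. *)
Lemma tmap_relmapl :
  (forall k j, \sum_i tens_act (tpure (b k i) (1 : A')) (X_ i j) = 0) ->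
  tmap (relmap b g) id X = 0.
Proof.
move=> rel; have RL := relmap_linear b g (W := W).
apply: tens_ffun_eq0 => c j; have cL := @fev_linear F _ (restr W) c.
rewrite (tmap_comp RL cL idL (jL j)).
case: c cL => [k|i] cL.
  rewrite -[RHS](rel k j); move: X; apply: linear_eq_tens => [||f f'].
  - exact: (tmap_linear (linear_comp RL cL) (jL j)).
  - apply: linear_sum_fun => i; apply: linear_comp; last exact: tens_act_linear.
    exact: (tmap_linear (iL i) (jL j)).
  rewrite (tmap_pure (linear_comp RL cL) (jL j)) /= /fev ffunE.
  rewrite /rowcomb (bilin_suml (bilin_tpure _ _)); apply: eq_bigr => i _.
  by rewrite (tmap_pure (iL i) (jL j)) tens_act_pure scale1r mxE.
have pL := mproj_linear (W := W) g.
transitivity (tmap (id \- mproj (W := W) g) id (X_ i j)).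
  rewrite (tmap_comp (iL i) (linear_sub idL pL) (jL j) idL).
  by congr (tmap _ _ X); apply/funext => f; rewrite /= /fev ffunE.
rewrite (tmap_subl idL pL idL) tmap_idP //.
have [s sP ->] := Xg i j; rewrite (tmap_sum_pure pL idL) -sumrB.
by rewrite big_seq big1 // => p /sP[Wp _]; rewrite mproj_hom ?subrr.
Qed.

Lemma tmap_relmapr :
  (forall k i, \sum_j tens_act (tpure (1 : A) (b' k j)) (X_ i j) = 0) ->
  tmap id (relmap b' g) X = 0.
Proof.
move=> rel; have RL := relmap_linear b' g (W := W').
apply: tens_ffun_eq0 => i c; have cL := @fev_linear F _ (restr W') c.
rewrite (tmap_comp idL (iL i) RL cL).
case: c cL => [k|j] cL.
  rewrite -[RHS](rel k i); move: X; apply: linear_eq_tens => [||f f'].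
  - exact: (tmap_linear (iL i) (linear_comp RL cL)).
  - apply: linear_sum_fun => j; apply: linear_comp; last exact: tens_act_linear.
    exact: (tmap_linear (iL i) (jL j)).
  rewrite (tmap_pure (iL i) (linear_comp RL cL)) /= /fev ffunE.
  rewrite /rowcomb (bilin_sumr (bilin_tpure _ _)); apply: eq_bigr => j _.
  by rewrite (tmap_pure (iL i) (jL j)) tens_act_pure scale1r mxE.
have pL := mproj_linear (W := W') g.
transitivity (tmap id (id \- mproj (W := W') g) (X_ i j)).
  rewrite (tmap_comp (iL i) idL (jL j) (linear_sub idL pL)).
  by congr (tmap _ _ X); apply/funext => f; rewrite /= /fev ffunE.
rewrite (tmap_subr idL idL pL) tmap_idP //.
have [s sP ->] := Xg i j; rewrite (tmap_sum_pure idL pL) -sumrB.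
by rewrite big_seq big1 // => p /sP[_ Wp]; rewrite mproj_hom ?subrr.
Qed.

End RelationKernel.

(** * Bijectivity of the comparison morphism *)

Section HomogeneousTensors.
Variables (F : fieldType) (G : groupType) (A A' : grAlg F G).
Variables (W : grMod A) (W' : grMod A').

Lemma gr_tens_lift (B B' : grAlg F G) g (x : tens B B') :
  tens_comp (acomp B) (acomp B') g x ->
  exists2 y : gr_tens B B', val y = x & acomp (gr_tens B B') g y.
Proof.
move=> xg; have xP : x \in gsub_pred (tens_family B B').
  apply/asboolP; apply: sum_of_hom xg => h.
  exact: (subspace_subgroup (@tens_acomp_sub _ _ B B' h)).
by exists (exist _ x xP).
Qed.

Lemma tens_comp_pure (V V' : lmodType F) (C : G -> set V) (D : G -> set V')
    g v v' :
  C g v -> D g v' -> tens_comp C D g (tpure v v').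
Proof.
move=> Cv Dv; exists [:: (v, v')]; last by rewrite big_seq1.
by move=> p; rewrite inE => /eqP ->.
Qed.

Lemma gr_tens_pure g (a : A) (a' : A') : acomp A g a -> acomp A' g a' ->
  exists y : gr_tens A A', val y = tpure a a'.
Proof.
move=> Aa Aa'; have [y yE _] := gr_tens_lift (tens_comp_pure Aa Aa').
by exists y.
Qed.

Lemma gr_tensM_pure g (w : W) (w' : W') : mcomp W g w -> mcomp W' g w' ->
  exists x : gr_tensM W W', val x = tpure (w : restr W) (w' : restr W').
Proof.
move=> Ww Ww'.
have xP : tpure (w : restr W) (w' : restr W') \in @tensM_pred _ _ _ _ W W'.
  apply/asboolP/(sum_of_hom (@tens_mcomp_subg _ _ _ _ W W') (g := g)).
  exact: tens_comp_pure.
by exists (exist _ (tpure (w : restr W) (w' : restr W')) xP).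
Qed.

End HomogeneousTensors.

Section ComparisonBijective.
Variables (F : fieldType) (G : groupType) (A A' : grAlg F G).
Variables (W : grMod A) (W' : grMod A').
Local Notation E := (gr_rEnd W).
Local Notation E' := (gr_rEnd W').

Variables (m n : nat) (u : 'I_n -> W) (b : 'M[A]_(m, n)).
Hypotheses (ub : presentation u b) (Wu : forall i, mcomp W 1%g (u i)).
Hypothesis (Ab : forall k i, acomp A 1%g (b k i)).
Variables (m' n' : nat) (u' : 'I_n' -> W') (b' : 'M[A']_(m', n')).
Hypotheses (ub' : presentation u' b') (Wu' : forall i, mcomp W' 1%g (u' i)).
Hypothesis (Ab' : forall k i, acomp A' 1%g (b' k i)).

Lemma tens_endo_evalgens (x : tens E E') i j :
  tens_endo x (tpure (u i : restr W) (u' j : restr W')) =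
  tmap (fev i) (fev j) (tmap (evalgens u) (evalgens u') x).
Proof.
have eL := @evalgens_linear _ _ _ _ _ u.
have eL' := @evalgens_linear _ _ _ _ _ u'.
have fL := @fev_linear F 'I_n (restr W) i.
have fL' := @fev_linear F 'I_n' (restr W') j.
move: x; apply: linear_eq_tens => [||phi psi].
- exact: tens_endo_linearl.
- exact: (linear_comp (tmap_linear eL eL') (tmap_linear fL fL')).
by rewrite (tmap_pure eL eL') (tmap_pure fL fL') tens_endo_pure /fev !ffunE.
Qed.

(** The hypothesis says that the coordinates of the image of x under the
    injective map [tmap (evalgens u) (evalgens u')] vanish. *)
Lemma comparison_ker (x : gr_tens E E') :
  (forall i j,
     tens_endo (val x) (tpure (u i : restr W) (u' j : restr W')) = 0) ->
  x = 0.
Proof.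
move=> x0; apply: val_inj.
apply: (tmap_inj0 (evalgens_linear u) (evalgens_linear u')
                  (evalgens_inj ub) (evalgens_inj ub')).
by apply: tens_ffun_eq0 => i j; rewrite -tens_endo_evalgens; apply: x0.
Qed.

Let S : set (gr_tensM W W') :=
  [set w | exists i j, val w = tpure (u i : restr W) (u' j : restr W')].

(** For w in W_h and w' in W'_h, the coefficients of w and w' in the generators
    can be taken in A_h and A'_h, so that their tensor products belong to the
    graded product of the algebras. *)
Lemma gr_tensM_span (w : gr_tensM W W') : lspan S w.
Proof.
elim/mcomp_ind: w => [|x y|h w]; [exact: lspan0|exact: lspanD|].
move=> [s]; elim: s w => [|[v v'] s IH] w sP.
  by rewrite big_nil => w0; have -> : w = 0 by [apply: val_inj]; apply: lspan0.
rewrite big_cons /= => wE.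
have [/= Wv Wv'] := sP (v, v') (mem_head _ _).
have sP' p : p \in s -> mcomp W h p.1 /\ mcomp W' h p.2.
  by move=> ps; apply: sP; rewrite inE ps orbT.
have [w1 w1E] := gr_tensM_pure Wv Wv'.
have -> : w = w1 + (w - w1) by rewrite addrC subrK.
apply: lspanD; last first.
  by apply: IH sP' _; rewrite raddfB /= w1E wE addrC addKr.
have [a Aa vE] := homogeneous_rowcomb ub Wu Wv.
have [a' Aa' vE'] := homogeneous_rowcomb ub' Wu' Wv'.
have [c cE] := choice (fun ij : 'I_n * 'I_n' =>
  gr_tens_pure (Aa ij.1) (Aa' ij.2)).
have [q qE] := choice (fun ij : 'I_n * 'I_n' =>
  gr_tensM_pure (Wu ij.1) (Wu' ij.2)).
suff -> : w1 = \sum_i \sum_j c (i, j) *: q (i, j).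
  apply: lspan_sum => i _; apply: lspan_sum => j _; apply/lspanZ/lspan_gen.
  by exists i, j; rewrite qE.
apply: val_inj; rewrite w1E vE vE' raddf_sum /rowcomb.
rewrite (bilin_suml (bilin_tpure _ _)); apply: eq_bigr => i _.
rewrite raddf_sum (bilin_sumr (bilin_tpure _ _)); apply: eq_bigr => j _.
rewrite /= cE qE; apply: esym; exact: tens_act_pure.
Qed.

Variable w : 'I_n -> 'I_n' -> gr_tensM W W'.
Hypothesis wE : forall i j,
  val (w i j) = tpure (u i : restr W) (u' j : restr W').

(** The relation matrix has entries of degree 1, so b_ki tensor 1 lies in the
    graded product of the algebras and commutes with theta. *)
Lemma rEnd_relationl (theta : rEnd (gr_tensM W W')) k j :
  \sum_i tens_act (tpure (b k i) (1 : A')) (val (theta (w i j))) = 0.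
Proof.
have [y yE] := choice (fun i => gr_tens_pure (Ab k i) (acomp1 A')).
have ->: \sum_i tens_act (tpure (b k i) (1 : A')) (val (theta (w i j))) =
    val (theta (\sum_i y i *: w i j)).
  rewrite /rEnd_fun linear_sum raddf_sum; apply: eq_bigr => i _.
  by rewrite linearZ -(yE i).
have -> : \sum_i y i *: w i j = 0; last by rewrite rEnd0.
apply: val_inj; rewrite raddf_sum /=.
transitivity (tpure (rowcomb u (row k b) : restr W) (u' j : restr W')).
  rewrite /rowcomb (bilin_suml (bilin_tpure _ _)); apply: eq_bigr => i _.
  transitivity (tens_act (val (y i)) (val (w i j))); first by [].
  by rewrite yE wE tens_act_pure scale1r mxE.
by rewrite (presentation_rel _ ub) tpure0l.
Qed.

Lemma rEnd_relationr (theta : rEnd (gr_tensM W W')) k i :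
  \sum_j tens_act (tpure (1 : A) (b' k j)) (val (theta (w i j))) = 0.
Proof.
have [y yE] := choice (fun j => gr_tens_pure (acomp1 A) (Ab' k j)).
have ->: \sum_j tens_act (tpure (1 : A) (b' k j)) (val (theta (w i j))) =
    val (theta (\sum_j y j *: w i j)).
  rewrite /rEnd_fun linear_sum raddf_sum; apply: eq_bigr => j _.
  by rewrite linearZ -(yE j).
have -> : \sum_j y j *: w i j = 0; last by rewrite rEnd0.
apply: val_inj; rewrite raddf_sum /=.
transitivity (tpure (u i : restr W) (rowcomb u' (row k b') : restr W')).
  rewrite /rowcomb (bilin_sumr (bilin_tpure _ _)); apply: eq_bigr => j _.
  transitivity (tens_act (val (y j)) (val (w i j))); first by [].
  by rewrite yE wE tens_act_pure scale1r mxE.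
by rewrite (presentation_rel _ ub') tpure0r.
Qed.

(** The values of theta at the tensors of generators form an element X that both
    relation maps kill; so X is a sum of pure tensors of value vectors of
    endomorphisms of degree g. *)
Lemma comparison_surj g theta : acomp (gr_rEnd (gr_tensM W W')) g theta ->
  exists2 x, acomp (gr_tens E E') g x & comparison x = theta.
Proof.
move=> thetag; set th := val theta.
have [X XE] := tens_ffun_exists (fun i j => val (th (w i j))).
have Xg i j : tens_mcomp g (tmap (fev i) (fev j) X).
  rewrite XE -(mul1g g); apply: thetag; rewrite /= /tensM_comp /= wE.
  exact: tens_comp_pure.
have Xl : tmap (relmap b g) id X = 0.
  apply: tmap_relmapl Xg _ => k j; rewrite -[RHS](rEnd_relationl th k j).
  by apply: eq_bigr => i _; rewrite XE.
have Xr : tmap id (relmap b' g) X = 0.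
  apply: tmap_relmapr Xg _ => k i; rewrite -[RHS](rEnd_relationr th k i).
  by apply: eq_bigr => j _; rewrite XE.
have [s sP XsE] := tmap_ker (relmap_linear b g (W := W))
                            (relmap_linear b' g (W := W')) Xl Xr.
have evL := tmap_linear (evalgens_linear u) (evalgens_linear u').
have [x0 x0g x0E] : exists2 x0 : tens E E',
    tens_comp (acomp E) (acomp E') g x0 &
    tmap (evalgens u) (evalgens u') x0 = X.
  rewrite XsE; elim: s sP {XsE} => [|p s IH] sP.
    exists 0; first by exists [::]; rewrite ?big_nil.
    by rewrite big_nil (lin0 evL).
  have [|x0 x0g x0E] := IH.
    by move=> q qs; apply: sP; rewrite inE qs orbT.
  have [/(relmap_endo ub Wu)[phi phig phiE]] := sP p (mem_head _ _).
  move=> /(relmap_endo ub' Wu')[psi psig psiE].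
  exists (tpure phi psi + x0).
    have [s0 sD] := tens_acomp_sub E E' g.
    have := sD 1 (tpure phi psi) x0; rewrite scale1r; apply=> //.
    exact: tens_comp_pure.
  rewrite big_cons (linD evL) x0E.
  by rewrite (tmap_pure (evalgens_linear u) (evalgens_linear u')) phiE psiE.
have [x xE xg] := gr_tens_lift x0g; exists x => //.
apply/val_inj/rEndP => v.
apply: (rEnd_eq_lspan _ (gr_tensM_span v)) => q [i [j qE]].
have -> : q = w i j by apply: val_inj; rewrite wE.
by apply: val_inj; rewrite comparison_rEndE xE wE tens_endo_evalgens x0E XE.
Qed.

End ComparisonBijective.

Theorem corollary4p31 (F : fieldType) (G : groupType)
    (A A' : grAlg F G) (W : grMod A) (W' : grMod A') :
  strongly_graded A -> strongly_graded A' ->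
  finitely_presented W -> finitely_presented W' ->
  gr_isomorphic (gr_tens (gr_rEnd W) (gr_rEnd W')) (gr_rEnd (gr_tensM W W')).
Proof.
move=> As As' /(graded_presentation As)[m [n [u [b [ub Wu Ab]]]]].
move=> /(graded_presentation As')[m' [n' [u' [b' [ub' Wu' Ab']]]]].
have [w wE] := choice (fun ij : 'I_n * 'I_n' =>
  gr_tensM_pure (Wu ij.1) (Wu' ij.2)).
have cL := @comparison_linear F G A A' W W'.
have c0 (x : gr_tens (gr_rEnd W) (gr_rEnd W')) : comparison x = 0 -> x = 0.
  move=> /(congr1 val) x0; apply: (comparison_ker ub ub') => i j.
  rewrite -(wE (i, j)) -(comparison_rEndE x).
  by rewrite (_ : comparison_rEnd x = 0).
have cI : injective (@comparison F G A A' W W').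
  move=> x y xy; apply/eqP; rewrite -subr_eq0; apply/eqP/c0.
  by rewrite (linB cL) xy subrr.
have cS g := comparison_surj ub Wu Ab ub' Wu' Ab' (w := fun i j => w (i, j))
  (fun i j => wE (i, j)) (g := g).
have cSall theta :
    exists x : gr_tens (gr_rEnd W) (gr_rEnd W'), comparison x = theta.
  elim/acomp_ind: theta => [|t t' [x <-] [x' <-]|g t /cS[x _ <-]].
  - by exists 0; apply: (lin0 cL).
  - by exists (x + x'); apply: (linD cL).
  - by exists x.
exists (HB.pack_for {linear gr_tens (gr_rEnd W) (gr_rEnd W') ->
    gr_rEnd (gr_tensM W W')} (@comparison F G A A' W W')
    (GRing.isLinear.Build F _ _ _ _ cL)); split=> /=.
- have [d dE] := choice cSall; exists d => // x; exact: cI.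
- exact: comparison1.
- exact: comparisonM.
move=> g x; split; first exact: comparison_comp.
(* the preimage found in degree g is the only one *)
by move=> xg; have [y yg /cI <-] := cS g (comparison x) xg.
Qed.
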